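(* Consider the line network model (see context) with $\ell$ links and erasure probabilities $p_1,\dots,p_\ell$, and assume there is a unique worst link: there is an index $m$ with $p_m:=\max_{1\le i\le \ell}p_i<1$ and $p_i<p_m$ for all $i\neq m$. For $n\ge 1$ define the delay function $$D(n,p_1,\dots,p_\ell):=\mathbb{E}T_n-\frac{n}{1-p_m},$$ so that $\mathbb{E}T_n=\frac{n}{1-\max_i p_i}+D(n,p_1,\dots,p_\ell)$. Then $n\mapsto D(n,p_1,\dots,p_\ell)$ is non-decreasing in $n$, and for every $n\ge1$ $$D(n,p_1,\dots,p_\ell)\le \bar D(p_1,\dots,p_\ell):=\sum_{i=1,\,i\neq m}^{\ell}\frac{p_m}{p_m-p_i}.$$
   Context: Line network model. Fix integers $\ell\ge1$, $n\ge1$ and erasure probabilities $p_1,\dots,p_\ell\in[0,1)$. Let $\{z_{t,i}: t\ge1,\,1\le i\le\ell\}$ be independent Bernoulli random variables with $\mathbb{P}(z_{t,i}=1)=1-p_i$ ($z_{t,i}=1$ means link $i$ is ON at time step $t$, $z_{t,i}=0$ means the packet sent on it at step $t$ is erased). There are nodes $N^{(1)},\dots,N^{(\ell+1)}$, link $i$ going from $N^{(i)}$ to $N^{(i+1)}$; the source $N^{(1)}$ holds $n$ packets, and at every time step each node $N^{(i)}$, $i\le \ell$, sends over link $i$ a random linear combination of all packets it has received (idealized so that a transmission is innovative whenever possible). Let $\rho_i(t)$ be the rank (dimension of the span of packets held) of node $N^{(i)}$ after $t$ time steps: $\rho_1(t)=n$ for all $t\ge0$, $\rho_i(0)=0$ for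 $2\le i\le \ell+1$, and for $t\ge1$, $1\le i\le\ell$, $$\rho_{i+1}(t)=\rho_{i+1}(t-1)+z_{t,i}\,\mathbf 1\{\rho_i(t-1)>\rho_{i+1}(t-1)\}.$$ The rank difference $\rho_i-\rho_{i+1}$ is the number of innovative packets at node $N^{(i)}$. The completion time is $T_n:=\min\{t\ge0:\rho_{\ell+1}(t)=n\}$, the time for the destination $N^{(\ell+1)}$ to be able to decode all $n$ packets. *)

(* Defs.v *)
From Stdlib Require Import Reals List Arith Bool.
Import ListNotations.
Open Scope R_scope.

(* A realisation of the link states: z t i = true iff link i is ON at step t
   (t >= 1, 1 <= i <= l). *)
Definition onoff := nat -> nat -> bool.

(* Ranks after t steps, as a function of the node index i (1..l+1).
   rho z n t 1 = n ; rho z n 0 i = 0 (i >= 2);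
   rho z n t i = rho z n (t-1) i + z t (i-1) * 1{rho (t-1) (i-1) > rho (t-1) i}. *)
Fixpoint rho (z : onoff) (n : nat) (t : nat) : nat -> nat :=
  match t with
  | O => fun i => if Nat.eqb i 1 then n else O
  | S t' =>
      let r := rho z n t' in
      fun i => if Nat.eqb i 1 then n
               else if Nat.leb 2 i then
                 (r i + (if z t (i - 1) && Nat.ltb (r i) (r (i - 1)) then 1 else 0))%nat
               else O
  end.

Definition Tn_eq (l n t : nat) (z : onoff) : bool :=
  Nat.eqb (rho z n t (l + 1)) n &&
  forallb (fun s => negb (Nat.eqb (rho z n s (l + 1)) n)) (seq 0 t).

Fixpoint all_bits (k : nat) : list (list bool) :=
  match k with
  | O => [[]]
  | S k' => flat_map (fun r => [true :: r; false :: r]) (all_bits k')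
  end.

Fixpoint all_configs (l t : nat) : list (list (list bool)) :=
  match t with
  | O => [[]]
  | S t' => flat_map (fun c => map (fun row => c ++ [row]) (all_bits l))
                     (all_configs l t')
  end.

Definition z_of (c : list (list bool)) : onoff :=
  fun s i => nth (i - 1) (nth (s - 1) c []) false.

Fixpoint row_weight (p : nat -> R) (i : nat) (row : list bool) : R :=
  match row with
  | [] => 1
  | b :: r => (if b then 1 - p i else p i) * row_weight p (S i) r
  end.

Definition config_weight (p : nat -> R) (c : list (list bool)) : R :=
  fold_right (fun row acc => row_weight p 1 row * acc) 1 c.

(* Probability (under independent Bernoulli link states) of an event
   that depends only on the first t steps. *)
Definition prob_upto (l : nat) (p : nat -> R) (t : nat) (E : onoff -> bool) : R :=
  fold_right Rplus 0
    (map (fun c => if E (z_of c) then config_weight p c else 0) (all_configs l t)).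

Definition P_Tn_eq (l : nat) (p : nat -> R) (n t : nat) : R :=
  prob_upto l p t (Tn_eq l n t).

Definition Dbar (l : nat) (p : nat -> R) (m : nat) : R :=
  fold_right Rplus 0
    (map (fun i => if Nat.eqb i m then 0 else p m / (p m - p i)) (seq 1 l)).

(* Main.v *)
Require Import Defs.
From Stdlib Require Import Reals List Arith Bool.
From Stdlib Require Import ZArith Lia Lra FunctionalExtensionality.
Import ListNotations.
Open Scope R_scope.

(** Let [G(i,j)] be the time at which packet [j] has crossed link [i]; it solves
    the last-passage recursion [G(i,j) = max (G(i-1,j), G(i,j-1)) + S_ij] with
    independent geometric [S_ij], and [T_n = G(l,n)].

    Monotonicity of the delay: crossing of optimal paths (the Monge property)
    makes [E T_n] concave in [n]; as moreover [E T_n >= n / (1 - p_m)], no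
    increment can be smaller than [1 / (1 - p_m)].

    Upper bound: crossing of paths also gives
    [G_{1..l} + G_m <= G_{m..l} + G_{1..m}], and reversing both coordinates turns
    the last term into [G_{m..1}], so the worst link may be assumed to come
    first. A link [i] behind the worst one is then removed as follows. Starting
    its queue in the stationary law instead of empty saves at most (mean queue) /
    (1 - p_m) = [p_m / (p_m - p_i)], because the worst link needs time
    [1 / (1 - p_m)] per packet; and by Burke's theorem the stationary queue has
    Bernoulli output of parameter [1 - p_m], exactly that of the worst link.

    All expectations are cut at a horizon [tau], which makes them finite sums. *)

(** * The rank chain and removal of a link by Burke's theorem *)

(* One step of the chain of ranks [rs = [rho_2; ...; rho_{l+1}]], seen as an
   averaging operator on functions of [rs]; [up] is the rank of the node feeding
   the first one. Each link compares the ranks before the step. *)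
Fixpoint step_exp (ps : list R) (rs : list nat) (up : nat) (f : list nat -> R) : R :=
  match ps, rs with
  | p :: ps', r :: rs' =>
      if (r <? up)%nat
      then (1 - p) * step_exp ps' rs' r (fun v => f (S r :: v))
           + p * step_exp ps' rs' r (fun v => f (r :: v))
      else step_exp ps' rs' r (fun v => f (r :: v))
  | _, _ => f []
  end.

(* E min(T, tau) for the chain started at [rs], with n packets at the source. *)
Fixpoint mean_time (ps : list R) (n tau : nat) (rs : list nat) : R :=
  match tau with
  | O => 0
  | S tau' =>
      (if (last rs n <? n)%nat then 1 else 0)
      + step_exp ps rs n (mean_time ps n tau')
  end.

Definition is_prob (p : R) : Prop := 0 <= p <= 1.

Lemma step_exp_ext (ps : list R) (rs : list nat) (up n : nat) (f g : list nat -> R) :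
  length ps = length rs -> (up <= n)%nat -> Forall (fun r => (r <= n)%nat) rs ->
  (forall v, length v = length rs -> Forall (fun r => (r <= n)%nat) v -> f v = g v) ->
  step_exp ps rs up f = step_exp ps rs up g.
Proof.
  revert rs up f g; induction ps as [|p ps IH]; intros [|r rs] up f g Hl Hup Hn H;
    simpl in *; try discriminate.
  - apply H; auto.
  - inversion Hn; subst.
    assert (E : forall s, (s <= n)%nat ->
      step_exp ps rs r (fun v => f (s :: v)) = step_exp ps rs r (fun v => g (s :: v))).
    { intros s Hs; apply IH; auto. intros v Hv1 Hv2; apply H; simpl; auto. }
    destruct (Nat.ltb_spec r up).
    + rewrite !E by lia; reflexivity.
    + apply E; lia.
Qed.

Lemma step_exp_linear (ps : list R) (rs : list nat) (up : nat) (a b : R) (f g : list nat -> R) :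
  step_exp ps rs up (fun v => a * f v + b * g v)
  = a * step_exp ps rs up f + b * step_exp ps rs up g.
Proof.
  revert rs up f g; induction ps as [|p ps IH]; intros [|r rs] up f g; simpl; auto.
  destruct (r <? up)%nat; rewrite !IH; ring.
Qed.

(** The two chains can disagree on whether a link is active only when both receiving ranks are at
    least [n], and there one more packet is invisible after truncation. *)
Lemma step_exp_trunc (n : nat) (ps : list R) (rs rs' : list nat) (up up' : nat)
    (f g : list nat -> R) :
  Forall2 (fun r r' => Nat.min r n = Nat.min r' n) rs rs' ->
  Nat.min up n = Nat.min up' n ->
  (forall v v', Forall2 (fun r r' => Nat.min r n = Nat.min r' n) v v' -> f v = g v') ->
  step_exp ps rs up f = step_exp ps rs' up' g.
Proof.
  intros H; revert ps up up' f g.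
  induction H as [|r r' rs rs' Hr _ IH]; intros [|p ps] up up' f g Hup Hfg;
    simpl; try (apply Hfg; constructor).
  assert (E : forall s s', Nat.min s n = Nat.min s' n ->
    step_exp ps rs r (fun v => f (s :: v)) = step_exp ps rs' r' (fun v => g (s' :: v))).
  { intros s s' Hs. apply IH; auto. }
  destruct (Nat.ltb_spec r up), (Nat.ltb_spec r' up').
  - rewrite (E (S r) (S r')), (E r r') by lia; ring.
  - rewrite (E (S r) r'), (E r r') by lia; ring.
  - rewrite <- (E r (S r')), <- (E r r') by lia; ring.
  - apply E; lia.
Qed.

(** Monotone coupling with the same link states: if only the lower chain advances, then
    [r < up <= up' <= r'], so [S r <= r'] and the order is kept. *)
Lemma step_exp_antitone (ps : list R) (rs rs' : list nat) (up up' : nat) (f g : list nat -> R) :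
  Forall is_prob ps -> Forall2 le rs rs' -> (up <= up')%nat ->
  (forall v v', Forall2 le v v' -> g v' <= f v) ->
  step_exp ps rs' up' g <= step_exp ps rs up f.
Proof.
  intros Hp H; revert ps up up' f g Hp.
  induction H as [|r r' rs rs' Hr _ IH]; intros [|p ps] up up' f g Hp Hup Hfg;
    simpl; try (apply Hfg; constructor).
  inversion Hp as [|? ? [Hp0 Hp1] Hps]; subst.
  assert (E : forall s s', (s <= s')%nat ->
    step_exp ps rs' r' (fun v => g (s' :: v)) <= step_exp ps rs r (fun v => f (s :: v))).
  { intros s s' Hs. apply IH; auto. }
  pose proof (E r r' Hr) as E1.
  destruct (Nat.ltb_spec r up), (Nat.ltb_spec r' up').
  - pose proof (E (S r) (S r') ltac:(lia)). nra.
  - pose proof (E (S r) r' ltac:(lia)). nra.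
  - pose proof (E r (S r') ltac:(lia)). nra.
  - exact E1.
Qed.

Lemma Forall2_refl_gen {A : Type} (Q : A -> A -> Prop) (xs : list A) :
  (forall x, Q x x) -> Forall2 Q xs xs.
Proof. intros H; induction xs; constructor; auto. Qed.

Lemma step_exp_le (ps : list R) (rs : list nat) (up : nat) (f : list nat -> R) :
  Forall is_prob ps -> length ps = length rs ->
  (forall v v', Forall2 le v v' -> f v' <= f v) ->
  step_exp ps rs up f <= f rs.
Proof.
  revert rs up f; induction ps as [|p ps IH]; intros [|r rs] up f Hp Hl Hf;
    simpl in *; try discriminate; try lra.
  inversion Hp as [|? ? [Hp0 Hp1] Hps]; subst.
  assert (E : forall s, step_exp ps rs r (fun v => f (s :: v)) <= f (s :: rs)).
  { intros s; apply (IH rs r (fun v => f (s :: v))); auto. }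
  pose proof (E r). pose proof (E (S r)).
  assert (f (S r :: rs) <= f (r :: rs)).
  { apply Hf. constructor; [lia | apply Forall2_refl_gen; auto]. }
  destruct (r <? up)%nat; nra.
Qed.

Lemma last_Forall2 (Q : nat -> nat -> Prop) (d d' : nat) (v v' : list nat) :
  Forall2 Q v v' -> Q d d' -> Q (last v d) (last v' d').
Proof.
  intros H; revert d d'; induction H as [|a b v v' Hab H IH]; intros d d' Hd; auto.
  destruct H as [|a2 b2 v v' Hab2 H]; auto. apply (IH d d' Hd).
Qed.

Lemma mean_time_trunc (ps : list R) (n tau : nat) (v v' : list nat) :
  Forall2 (fun r r' => Nat.min r n = Nat.min r' n) v v' ->
  mean_time ps n tau v = mean_time ps n tau v'.
Proof.
  revert v v'; induction tau as [|tau IH]; intros v v' H; simpl; auto.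
  f_equal.
  - pose proof (last_Forall2 _ n n _ _ H eq_refl) as E. cbv beta in E.
    destruct (Nat.ltb_spec (last v n) n), (Nat.ltb_spec (last v' n) n); auto; lia.
  - apply (step_exp_trunc n); auto.
Qed.

Lemma mean_time_antitone (ps : list R) (n tau : nat) (v v' : list nat) :
  Forall is_prob ps -> Forall2 le v v' -> mean_time ps n tau v' <= mean_time ps n tau v.
Proof.
  intros Hp; revert v v'; induction tau as [|tau IH]; intros v v' H; simpl; [lra|].
  apply Rplus_le_compat.
  - pose proof (last_Forall2 _ n n _ _ H (le_n n)) as E.
    destruct (Nat.ltb_spec (last v n) n), (Nat.ltb_spec (last v' n) n); try lra; lia.
  - apply step_exp_antitone; auto.
Qed.

Lemma mean_time_incr (ps : list R) (n tau : nat) (v : list nat) :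
  Forall is_prob ps -> mean_time ps n tau v <= mean_time ps n (S tau) v.
Proof.
  intros Hp.
  assert (E0 : forall w, 0 <= (if (last w n <? n)%nat then 1 else 0)).
  { intros w; destruct (last w n <? n)%nat; lra. }
  (* Stated for ordered pairs of states, the claim is exactly what [step_exp_antitone] asks of its
     integrands. *)
  assert (H : forall tau w w', Forall2 le w w' ->
                mean_time ps n tau w' <= mean_time ps n (S tau) w).
  { clear tau v. induction tau as [|tau IH]; intros w w' H.
    - simpl. pose proof (E0 w).
      assert (0 <= step_exp ps w n (fun _ => 0)).
      { apply Rle_trans with (step_exp ps w n (fun v => 0 * 0 + 0 * 0)).
        - rewrite step_exp_linear; lra.
        - apply step_exp_antitone; auto using Forall2_refl_gen. intros; lra. }
      lra.
    - change (mean_time ps n (S tau) w') with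
        ((if (last w' n <? n)%nat then 1 else 0) + step_exp ps w' n (mean_time ps n tau)).
      change (mean_time ps n (S (S tau)) w) with
        ((if (last w n <? n)%nat then 1 else 0) + step_exp ps w n (mean_time ps n (S tau))).
      apply Rplus_le_compat.
      + pose proof (last_Forall2 _ n n _ _ H (le_n n)) as E.
        destruct (Nat.ltb_spec (last w n) n), (Nat.ltb_spec (last w' n) n); try lra; lia.
      + apply step_exp_antitone; auto. }
  apply H. apply Forall2_refl_gen; auto.
Qed.

(* A source that has sent all its packets may as well keep sending: ranks above
   [n] do not matter. *)
Lemma mean_time_source (p : R) (ps : list R) (n tau r : nat) (rs : list nat) :
  mean_time (p :: ps) n (S tau) (r :: rs)
  = (if (last (r :: rs) n <? n)%nat then 1 else 0)
    + (1 - p) * step_exp ps rs r (fun v => mean_time (p :: ps) n tau (S r :: v))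
    + p * step_exp ps rs r (fun v => mean_time (p :: ps) n tau (r :: v)).
Proof.
  cbn [mean_time step_exp].
  destruct (Nat.ltb_spec r n); [ring|].
  replace (step_exp ps rs r (fun v => mean_time (p :: ps) n tau (S r :: v)))
    with (step_exp ps rs r (fun v => mean_time (p :: ps) n tau (r :: v))); [ring|].
  f_equal. apply functional_extensionality; intros v.
  apply mean_time_trunc. constructor; [lia | apply Forall2_refl_gen; auto].
Qed.

(* Blocking all links but the first until the latter succeeds once costs
   1 / (1 - p) on average. *)
Lemma mean_time_one_ahead (p : R) (ps : list R) (n tau r : nat) (rs : list nat) :
  p < 1 -> Forall is_prob (p :: ps) -> length ps = length rs ->
  mean_time (p :: ps) n tau (r :: rs)
  <= / (1 - p) + mean_time (p :: ps) n tau (S r :: rs).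
Proof.
  intros Hp Hps Hl.
  (* Passing to horizon [S tau] and unfolding one step brings back the same [tau]: writing [M] for
     the mean, [M r <= 1 + (1 - p) * M (S r) + p * M r], which is solved for [M r]. *)
  pose proof (mean_time_incr (p :: ps) n tau (r :: rs) Hps) as Hi.
  rewrite mean_time_source in Hi.
  inversion Hps as [|? ? [Hp0 _] Hps']; subst.
  assert (E : forall s, step_exp ps rs r (fun v => mean_time (p :: ps) n tau (s :: v))
                        <= mean_time (p :: ps) n tau (s :: rs)).
  { intros s. apply (step_exp_le ps rs r (fun v => mean_time (p :: ps) n tau (s :: v))); auto.
    intros v v' Hv; apply mean_time_antitone; auto. }
  pose proof (E r) as E1. pose proof (E (S r)) as E2.
  assert (E0 : (if (last (r :: rs) n <? n)%nat then 1 else 0) <= 1)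
    by (destruct (last (r :: rs) n <? n)%nat; lra).
  apply Rmult_le_reg_l with (1 - p); [lra|].
  rewrite Rmult_plus_distr_l, Rinv_r by lra. nra.
Qed.

(** * The stationary queue behind the worst link *)

Section Burke.
Context (pm pi : R) (Hpi : 0 <= pi) (Hpm : pi < pm) (Hpm1 : pm < 1).

(** [t1] is the load of the queue, and [rr] is the ratio of its birth and death probabilities at
    nonzero length. *)
Let t1 := (1 - pm) / (1 - pi).
Let rr := (1 - pm) * pi / ((1 - pi) * pm).

(* Mean of [f (min Q K)] for the stationary queue length [Q], whose tail is
   P(Q > j) = t1 * rr ^ j, written by summation by parts. *)
Fixpoint stat_mean (K : nat) (f : nat -> R) : R :=
  match K with
  | O => f O
  | S K' => stat_mean K' f + t1 * rr ^ K' * (f K - f K')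
  end.

Lemma stat_mean_ext (K : nat) (f g : nat -> R) :
  (forall q, f q = g q) -> stat_mean K f = stat_mean K g.
Proof. intros H; induction K; simpl; rewrite ?IHK, ?H; auto. Qed.

Lemma stat_mean_linear (K : nat) (a b : R) (f g : nat -> R) :
  stat_mean K (fun q => a * f q + b * g q) = a * stat_mean K f + b * stat_mean K g.
Proof. induction K; simpl; rewrite ?IHK; ring. Qed.

Lemma stat_mean_const (K : nat) (c : R) : stat_mean K (fun _ => c) = c.
Proof. induction K; simpl; rewrite ?IHK; ring. Qed.

Lemma step_exp_stat_mean (K : nat) (ps : list R) (rs : list nat) (up : nat)
    (f : nat -> list nat -> R) :
  step_exp ps rs up (fun v => stat_mean K (fun q => f q v))
  = stat_mean K (fun q => step_exp ps rs up (f q)).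
Proof.
  induction K as [|K IH]; simpl; auto.
  rewrite <- IH.
  replace (fun v => stat_mean K (fun q => f q v) + t1 * rr ^ K * (f (S K) v - f K v))
    with (fun v => 1 * (1 * stat_mean K (fun q => f q v) + t1 * rr ^ K * f (S K) v)
                   + (- (t1 * rr ^ K)) * f K v)
    by (apply functional_extensionality; intros v; ring).
  rewrite (step_exp_linear _ _ _ _ _
    (fun v => 1 * stat_mean K (fun q => f q v) + t1 * rr ^ K * f (S K) v)).
  rewrite (step_exp_linear _ _ _ _ _ (fun v => stat_mean K (fun q => f q v))). ring.
Qed.

Lemma ratio_bounds : 0 <= rr < 1.
Proof.
  unfold rr; split.
  - apply Rle_mult_inv_pos; nra.
  - apply Rmult_lt_reg_r with ((1 - pi) * pm); [nra|].
    unfold Rdiv; rewrite Rmult_assoc, Rinv_l by nra. nra.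
Qed.

(** Each queued packet is worth at most [/ (1 - pm)], and the stationary mean length is
    [t1 / (1 - rr)]. Cutting the law at [K] only shortens the geometric sum. *)
Lemma stat_mean_lower (K : nat) (f : nat -> R) :
  (forall q, f q <= / (1 - pm) + f (S q)) ->
  f O <= pm / (pm - pi) + stat_mean K f.
Proof.
  intros H. pose proof ratio_bounds as Hr.
  assert (E : pm / (pm - pi) = t1 * / (1 - pm) / (1 - rr)).
  { unfold t1, rr. field. repeat split; nra. }
  assert (Ht : 0 < t1 * / (1 - pm)).
  { unfold t1. apply Rmult_lt_0_compat; [|apply Rinv_0_lt_compat; lra].
    apply Rdiv_lt_0_compat; lra. }
  assert (Ht1 : 0 < t1) by (unfold t1; apply Rdiv_lt_0_compat; lra).
  assert (P : f O <= t1 * / (1 - pm) * (1 - rr ^ K) / (1 - rr) + stat_mean K f).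
  { induction K as [|K IH]; simpl.
    - unfold Rdiv; rewrite Rminus_diag, Rmult_0_r, Rmult_0_l; lra.
    - replace (t1 * / (1 - pm) * (1 - rr * rr ^ K) / (1 - rr))
        with (t1 * / (1 - pm) * (1 - rr ^ K) / (1 - rr) + t1 * rr ^ K * / (1 - pm))
        by (field; lra).
      pose proof (pow_le rr K ltac:(lra)).
      assert (0 <= t1 * rr ^ K) by (apply Rmult_le_pos; lra).
      specialize (H K). nra. }
  apply Rle_trans with (1 := P). rewrite E.
  apply Rplus_le_compat_r. unfold Rdiv. apply Rmult_le_compat_r.
  - left; apply Rinv_0_lt_compat; lra.
  - pose proof (pow_le rr K ltac:(lra)). nra.
Qed.

(* One step of the queue with Bernoulli(1 - pm) arrivals and Bernoulli(1 - pi)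
   services; the new length is evaluated by [H1] after a departure and by [H0]
   otherwise. *)
Definition queue_step (H0 H1 : nat -> R) (q : nat) : R :=
  match q with
  | O => (1 - pm) * H0 1%nat + pm * H0 O
  | S q' => (1 - pm) * ((1 - pi) * H1 q + pi * H0 (S q))
            + pm * ((1 - pi) * H1 q' + pi * H0 q)
  end.

(** Cutting the stationary law at [S K] leaves a boundary term made of increments of [H0] and [H1]
    from [K] on; with this term explicit, the identity can be proved by induction on [K]. *)
Lemma burke_partial (H0 H1 : nat -> R) (K : nat) :
  stat_mean (S K) (queue_step H0 H1)
  = (1 - pm) * stat_mean K H1 + pm * stat_mean K H0
    + t1 * rr ^ K * ((1 - pm) * (1 - pi) * (H1 (S K) - H1 K)
                     + (1 - pm) * pi * (H0 (S (S K)) - H0 (S K))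
                     + pm * (H0 (S K) - H0 K)).
Proof.
  induction K as [|K IH].
  - simpl. unfold t1. field. lra.
  - change (stat_mean (S (S K)) (queue_step H0 H1)) with
      (stat_mean (S K) (queue_step H0 H1)
       + t1 * rr ^ S K * (queue_step H0 H1 (S (S K)) - queue_step H0 H1 (S K))).
    rewrite IH. cbn [stat_mean queue_step pow].
    (* Detailed balance between neighbouring nonzero lengths, the only property of [rr] behind the
       induction step. *)
    assert (E : rr * pm * (1 - pi) = (1 - pm) * pi) by (unfold rr; field; nra).
    assert (E' : rr * rr ^ K * pm * (1 - pi) = rr ^ K * ((1 - pm) * pi)) by (rewrite <- E; ring).
    clear - E'. generalize dependent (rr ^ K); intros x E'.
    set (a := H1 K). set (b := H1 (S K)). set (c := H1 (S (S K))).
    set (d := H0 K). set (e := H0 (S K)). set (f := H0 (S (S K))). set (g := H0 (S (S (S K)))).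
    apply Rminus_diag_uniq.
    transitivity (t1 * (b - a - f + e) * (rr * x * pm * (1 - pi) - x * ((1 - pm) * pi)));
      [ring | rewrite E'; ring].
Qed.

(** Burke's theorem: in stationarity a departure has probability [1 - pm] and is independent of the
    queue it leaves behind, which is again stationary. The boundary term vanishes by constancy from
    [K] on. *)
Lemma burke (H0 H1 : nat -> R) (K : nat) :
  (forall q, (K <= q)%nat -> H0 (S q) = H0 q) ->
  (forall q, (K <= q)%nat -> H1 (S q) = H1 q) ->
  stat_mean (S K) (queue_step H0 H1) = (1 - pm) * stat_mean K H1 + pm * stat_mean K H0.
Proof.
  intros C0 C1. rewrite burke_partial.
  rewrite (C1 K), (C0 (S K)), (C0 K) by lia. ring.
Qed.

(** By [burke], after one step the queue is stationary again whether or not a packet left, so the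
    average over [q] obeys the recursion of the network in which a link [pm] feeds [rs] directly. *)
Lemma mean_time_stationary (ps : list R) (n tau K : nat) (r : nat) (rs : list nat) :
  (n <= K)%nat ->
  stat_mean K (fun q => mean_time (pm :: pi :: ps) n tau ((r + q)%nat :: r :: rs))
  = mean_time (pm :: ps) n tau (r :: rs).
Proof.
  intros HK; revert r rs; induction tau as [|tau IH]; intros r rs.
  { simpl. apply stat_mean_const. }
  (* [H d q] is the mean remaining time if link [pi] delivers [d] packets in this step and is left
     with queue [q]. *)
  set (H := fun d q => step_exp ps rs r (fun v =>
              mean_time (pm :: pi :: ps) n tau ((r + d + q)%nat :: (r + d)%nat :: v))).
  set (phi := if (last (r :: rs) n <? n)%nat then 1 else 0).
  assert (C : forall d q, (K <= q)%nat -> H d (S q) = H d q).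
  { intros d q Hq. unfold H. f_equal. apply functional_extensionality; intros v.
    apply mean_time_trunc. constructor; [lia | apply Forall2_refl_gen; auto]. }
  assert (E : forall q, mean_time (pm :: pi :: ps) n (S tau) ((r + q)%nat :: r :: rs)
                        = 1 * phi + 1 * queue_step (H O) (H 1%nat) q).
  { intros q. rewrite mean_time_source. unfold phi.
    change (last ((r + q)%nat :: r :: rs) n) with (last (r :: rs) n).
    cbn [step_exp]. unfold queue_step, H.
    destruct q as [|q].
    - rewrite !Nat.add_0_r.
      destruct (Nat.ltb_spec r r); [lia|].
      rewrite (Nat.add_1_r r). ring.
    - destruct (Nat.ltb_spec r (r + S q)); [|lia].
      rewrite (Nat.add_1_r r), (Nat.add_0_r r).
      replace (S r + S q)%nat with (S (r + S q)) by lia.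
      replace (S r + q)%nat with (r + S q)%nat by lia.
      replace (r + S (S q))%nat with (S (r + S q)) by lia.
      ring. }
  (* [burke] loses one level of truncation; raising [K] to [S K] is free because ranks above [n] do
     not matter. *)
  assert (E' : stat_mean K (fun q => mean_time (pm :: pi :: ps) n (S tau) ((r + q)%nat :: r :: rs))
     = stat_mean (S K) (fun q => mean_time (pm :: pi :: ps) n (S tau) ((r + q)%nat :: r :: rs))).
  { cbn [stat_mean].
    rewrite (mean_time_trunc _ n (S tau) ((r + S K)%nat :: r :: rs) ((r + K)%nat :: r :: rs)).
    - ring.
    - constructor; [lia | apply Forall2_refl_gen; auto]. }
  rewrite E', (stat_mean_ext _ _ _ E), stat_mean_linear, stat_mean_const.
  rewrite burke by (intros; apply C; lia).
  rewrite mean_time_source. fold phi. unfold H.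
  rewrite <- !step_exp_stat_mean.
  replace (fun v => stat_mean K (fun q => mean_time (pm :: pi :: ps) n tau
             ((r + 0 + q)%nat :: (r + 0)%nat :: v)))
    with (fun v => mean_time (pm :: ps) n tau (r :: v))
    by (apply functional_extensionality; intros v; rewrite Nat.add_0_r; symmetry; apply IH).
  replace (fun v => stat_mean K (fun q => mean_time (pm :: pi :: ps) n tau
             ((r + 1 + q)%nat :: (r + 1)%nat :: v)))
    with (fun v => mean_time (pm :: ps) n tau (S r :: v))
    by (apply functional_extensionality; intros v; rewrite Nat.add_1_r; symmetry; apply IH).
  ring.
Qed.

Lemma mean_time_drop_server (ps : list R) (n tau : nat) (r : nat) (rs : list nat) :
  Forall is_prob ps -> length ps = length rs ->
  mean_time (pm :: pi :: ps) n tau (r :: r :: rs)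
  <= pm / (pm - pi) + mean_time (pm :: ps) n tau (r :: rs).
Proof.
  intros Hps Hl.
  rewrite <- (mean_time_stationary ps n tau n r rs (le_n n)).
  rewrite <- (Nat.add_0_r r) at 1.
  apply (stat_mean_lower n
    (fun q => mean_time (pm :: pi :: ps) n tau ((r + q)%nat :: r :: rs))).
  intros q. rewrite Nat.add_succ_r.
  apply mean_time_one_ahead; simpl; auto.
  repeat apply Forall_cons; auto; split; lra.
Qed.

End Burke.

(** Links are removed one by one, always the one directly behind the worst link. *)
Lemma mean_time_worst_first (pm : R) (ps : list R) (n tau : nat) :
  pm < 1 -> Forall (fun p => 0 <= p < pm) ps ->
  mean_time (pm :: ps) n tau (repeat O (S (length ps)))
  <= fold_right Rplus 0 (map (fun p => pm / (pm - p)) ps) + mean_time [pm] n tau [O].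
Proof.
  intros H1; induction ps as [|p ps IH]; intros H.
  - simpl. lra.
  - inversion H as [|? ? [Hp0 Hp] Hps]; subst. specialize (IH Hps). cbn [map fold_right].
    pose proof (mean_time_drop_server pm p Hp0 Hp H1 ps n tau O (repeat O (length ps))) as D.
    assert (Forall is_prob ps)
      by (eapply Forall_impl; [|exact Hps]; unfold is_prob; simpl; intros; lra).
    specialize (D ltac:(auto) ltac:(rewrite repeat_length; auto)).
    simpl in *. lra.
Qed.

(** * Completion time of a single link *)

Lemma mean_time_single_upper (p : R) (n tau r : nat) :
  0 <= p < 1 -> (r <= n)%nat -> mean_time [p] n tau [r] <= INR (n - r) / (1 - p).
Proof.
  intros Hp; revert r; induction tau as [|tau IH]; intros r Hr; cbn [mean_time step_exp].
  - apply Rle_mult_inv_pos; [apply pos_INR | lra].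
  - cbn [last]. destruct (Nat.ltb_spec r n).
    + pose proof (IH r Hr) as A. pose proof (IH (S r) ltac:(lia)) as B.
      replace (n - r)%nat with (S (n - S r)) in * by lia. rewrite S_INR in *.
      apply Rle_trans with (1 + ((1 - p) * (INR (n - S r) / (1 - p))
                                 + p * ((INR (n - S r) + 1) / (1 - p)))); [nra|].
      right; field; lra.
    + rewrite Rplus_0_l. apply IH; auto.
Qed.

(** Monotone convergence provides a limit, and the one-step recursion passed to the limit determines
    it. *)
Lemma mean_time_single_cv (p : R) (n k : nat) :
  0 <= p < 1 -> (k <= n)%nat ->
  Un_cv (fun tau => mean_time [p] n tau [(n - k)%nat]) (INR k / (1 - p)).
Proof.
  intros Hp; induction k as [|k IH]; intros Hk.
  - intros eps Heps; exists O; intros tau _.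
    replace (mean_time [p] n tau [(n - 0)%nat]) with 0.
    + unfold Rdist. simpl. unfold Rdiv. rewrite Rmult_0_l, Rminus_diag, Rabs_R0; auto.
    + rewrite Nat.sub_0_r. induction tau as [|tau IHt]; auto.
      cbn [mean_time step_exp last]. rewrite Nat.ltb_irrefl, <- IHt. ring.
  - specialize (IH ltac:(lia)).
    set (u := fun tau => mean_time [p] n tau [(n - S k)%nat]).
    set (w := fun tau => mean_time [p] n tau [(n - k)%nat]) in IH.
    assert (Hrec : forall tau, u (S tau) = 1 + (1 - p) * w tau + p * u tau).
    { intros tau. unfold u, w. rewrite mean_time_source. cbn [step_exp last].
      destruct (Nat.ltb_spec (n - S k) n); [|lia].
      replace (S (n - S k)) with (n - k)%nat by lia. ring. }
    assert (Hg : Un_growing u)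
      by (intros tau; apply mean_time_incr; repeat apply Forall_cons; auto; split; lra).
    destruct (growing_cv u Hg) as [L HL].
    { exists (INR (S k) / (1 - p)). intros y [tau ->]. unfold u.
      replace (S k) with (n - (n - S k))%nat at 2 by lia.
      apply mean_time_single_upper; auto; lia. }
    assert (HL1 : Un_cv (fun tau => u (S tau)) L).
    { intros eps Heps; destruct (HL eps Heps) as [N HN]; exists N; intros; apply HN; lia. }
    assert (HL2 : Un_cv (fun tau => 1 + (1 - p) * w tau + p * u tau)
                    (1 + (1 - p) * (INR k / (1 - p)) + p * L)).
    { assert (Hc : forall c, Un_cv (fun _ => c) c).
      { intros c eps Heps; exists O; intros; unfold Rdist;
          rewrite Rminus_diag, Rabs_R0; auto. }
      apply (CV_plus (fun tau => 1 + (1 - p) * w tau)).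
      - apply (CV_plus (fun _ => 1)); [apply Hc|]. apply (CV_mult (fun _ => 1 - p)); auto.
      - apply (CV_mult (fun _ => p)); auto. }
    assert (E : L = 1 + (1 - p) * (INR k / (1 - p)) + p * L).
    { apply UL_sequence with (1 := HL1). intros eps Heps.
      destruct (HL2 eps Heps) as [N HN]; exists N; intros m Hm.
      rewrite Hrec; apply HN; auto. }
    replace (INR (S k) / (1 - p)) with L; auto.
    rewrite S_INR. apply Rmult_eq_reg_r with (1 - p); [|lra].
    unfold Rdiv. rewrite Rmult_assoc, Rinv_l, Rmult_1_r by lra.
    replace ((1 - p) * (INR k / (1 - p))) with (INR k) in E by (field; lra). lra.
Qed.

(** * Last-passage representation *)

(** Integer coordinates keep the reversed indexing of the grid injective for all natural indices,
    where truncated subtraction would not. *)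
Definition key : Type := (Z * Z)%type.

Definition key_eqb (k k' : key) : bool := (fst k =? fst k')%Z && (snd k =? snd k')%Z.

Lemma key_eqb_spec (k k' : key) : reflect (k = k') (key_eqb k k').
Proof.
  destruct k as [a b], k' as [c d]; unfold key_eqb; simpl.
  destruct (Z.eqb_spec a c), (Z.eqb_spec b d); simpl; constructor; congruence.
Qed.

Definition upd (w : key -> nat) (k : key) (s : nat) : key -> nat :=
  fun k' => if key_eqb k k' then s else w k'.

Lemma upd_same (w : key -> nat) (k : key) (s : nat) : upd w k s k = s.
Proof. unfold upd; destruct (key_eqb_spec k k); congruence. Qed.

Lemma upd_other (w : key -> nat) (k k' : key) (s : nat) : k <> k' -> upd w k s k' = w k'.
Proof. unfold upd; destruct (key_eqb_spec k k'); congruence. Qed.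

Lemma upd_comm (w : key -> nat) (k k' : key) (s s' : nat) :
  k <> k' -> upd (upd w k s) k' s' = upd (upd w k' s') k s.
Proof.
  intros H; apply functional_extensionality; intros x; unfold upd.
  destruct (key_eqb_spec k' x), (key_eqb_spec k x); congruence.
Qed.

Lemma upd_upd (w : key -> nat) (k : key) (s s' : nat) : upd (upd w k s) k s' = upd w k s'.
Proof.
  apply functional_extensionality; intros x; unfold upd.
  destruct (key_eqb_spec k x); congruence.
Qed.

(* Mean of [g (min S (K + 1))] for S geometric on {1, 2, ...} with failure
   probability [p]. *)
Fixpoint geo (p : R) (K : nat) (g : nat -> R) : R :=
  match K with
  | O => g 1%nat
  | S K' => (1 - p) * g 1%nat + p * geo p K' (fun s => g (S s))
  end.

Lemma geo_ext (p : R) (K : nat) (f g : nat -> R) :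
  (forall s, f s = g s) -> geo p K f = geo p K g.
Proof. intros H. f_equal. apply functional_extensionality; auto. Qed.

Lemma geo_linear (p : R) (K : nat) (a b : R) (f g : nat -> R) :
  geo p K (fun s => a * f s + b * g s) = a * geo p K f + b * geo p K g.
Proof.
  revert f g; induction K as [|K IH]; intros f g; simpl; auto.
  rewrite (IH (fun s => f (S s))). ring.
Qed.

Lemma geo_const (p : R) (K : nat) (c : R) : geo p K (fun _ => c) = c.
Proof. induction K as [|K IH]; simpl; rewrite ?IH; ring. Qed.

Lemma geo_le (p : R) (K : nat) (f g : nat -> R) :
  is_prob p -> (forall s, f s <= g s) -> geo p K f <= geo p K g.
Proof.
  intros [H0 H1]; revert f g; induction K as [|K IH]; intros f g H; simpl; auto.
  pose proof (H 1%nat). pose proof (IH (fun s => f (S s)) (fun s => g (S s)) (fun s => H (S s))).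
  nra.
Qed.

Lemma geo_stable (p : R) (K : nat) (g : nat -> R) :
  (forall s, (K < s)%nat -> g (S s) = g s) -> geo p (S K) g = geo p K g.
Proof.
  revert g; induction K as [|K IH]; intros g H.
  - simpl. rewrite (H 1%nat) by lia. ring.
  - change (geo p (S (S K)) g) with
      ((1 - p) * g 1%nat + p * geo p (S K) (fun s => g (S s))).
    rewrite IH; [reflexivity|]. intros s Hs; apply H; lia.
Qed.

(** After a failed first attempt the number of further attempts has the original law. The cut at
    [K + 1] does not disturb this, because [g] is constant from there on. *)
Lemma geo_memoryless (p : R) (K : nat) (g : nat -> R) :
  (forall s, (K < s)%nat -> g (S s) = g s) ->
  geo p K g = (1 - p) * g 1%nat + p * geo p K (fun s => g (S s)).
Proof.
  intros H. destruct K as [|K].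
  - simpl. rewrite (H 1%nat) by lia. ring.
  - rewrite (geo_stable p K (fun s => g (S s))); [reflexivity|].
    intros s Hs; apply H; lia.
Qed.

Section Environment.
Context (q : key -> R) (K : nat).

(* Mean over independent weights at the keys [ks], key [k] having failure
   probability [q k]. *)
Fixpoint envE (ks : list key) (f : (key -> nat) -> R) (w : key -> nat) : R :=
  match ks with
  | [] => f w
  | k :: ks' => geo (q k) K (fun s => envE ks' f (upd w k s))
  end.

Definition capped (T : nat) (f : (key -> nat) -> R) : Prop :=
  forall w w', (forall k, Nat.min (w k) T = Nat.min (w' k) T) -> f w = f w'.

Lemma envE_ext (ks : list key) (f g : (key -> nat) -> R) (w : key -> nat) :
  (forall v, f v = g v) -> envE ks f w = envE ks g w.
Proof. intros H. f_equal. apply functional_extensionality; auto. Qed.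

Lemma envE_linear (ks : list key) (a b : R) (f g : (key -> nat) -> R) (w : key -> nat) :
  envE ks (fun v => a * f v + b * g v) w = a * envE ks f w + b * envE ks g w.
Proof.
  revert w; induction ks as [|k ks IH]; intros w; simpl; auto.
  rewrite <- geo_linear. apply geo_ext; auto.
Qed.

Lemma envE_const (ks : list key) (c : R) (w : key -> nat) : envE ks (fun _ => c) w = c.
Proof.
  revert w; induction ks as [|k ks IH]; intros w; simpl; auto.
  rewrite (geo_ext _ _ _ (fun _ => c)) by auto. apply geo_const.
Qed.

Lemma envE_le (ks : list key) (f g : (key -> nat) -> R) (w : key -> nat) :
  (forall k, In k ks -> is_prob (q k)) ->
  (forall v, f v <= g v) -> envE ks f w <= envE ks g w.
Proof.
  intros Hq H; revert w; induction ks as [|k ks IH]; intros w; simpl; auto.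
  apply geo_le; [apply Hq; left; auto|]. intros s; apply IH.
  intros; apply Hq; right; auto.
Qed.

Lemma envE_capped (T : nat) (ks : list key) (f : (key -> nat) -> R) :
  capped T f -> capped T (envE ks f).
Proof.
  intros Hf; induction ks as [|k ks IH]; simpl; auto.
  intros w w' H. apply geo_ext; intros s. apply IH; intros k'.
  unfold upd; destruct (key_eqb_spec k k'); auto.
Qed.

Lemma envE_upd_fresh (ks : list key) (f : (key -> nat) -> R) (k : key) (h : nat -> nat)
    (w : key -> nat) :
  ~ In k ks ->
  envE ks (fun v => f (upd v k (h (v k)))) w = envE ks f (upd w k (h (w k))).
Proof.
  revert w; induction ks as [|k' ks IH]; intros w H; simpl in *; auto.
  apply geo_ext; intros s. rewrite IH by tauto.
  assert (k' <> k) by tauto.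
  rewrite (upd_other w) by auto. rewrite upd_comm by auto. reflexivity.
Qed.

(** Only the first attempt at key [k] is revealed; after a failure its remaining weight is as good
    as new. [T <= S K] hides the cut of the geometric law from [f]. *)
Lemma envE_memoryless (T : nat) (ks : list key) (f : (key -> nat) -> R) (k : key)
    (w : key -> nat) :
  NoDup ks -> In k ks -> capped T f -> (T <= S K)%nat ->
  envE ks f w = (1 - q k) * envE ks (fun v => f (upd v k 1)) w
                + q k * envE ks (fun v => f (upd v k (S (v k)))) w.
Proof.
  intros Hnd Hin Hf HT; revert w; induction ks as [|k' ks IH]; intros w; [destruct Hin|].
  inversion Hnd as [|? ? Hni Hnd']; subst; simpl.
  destruct (key_eqb_spec k' k) as [->|Hk].
  - rewrite geo_memoryless.
    + f_equal; f_equal.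
      * rewrite (geo_ext _ _ _ (fun _ => envE ks f (upd w k 1))), geo_const; auto.
        intros s. rewrite (envE_upd_fresh ks f k (fun _ => 1%nat)) by auto.
        rewrite upd_upd; auto.
      * apply geo_ext; intros s.
        rewrite (envE_upd_fresh ks f k S) by auto.
        rewrite upd_upd, upd_same; auto.
    + intros s Hs. apply (envE_capped T ks f Hf). intros k'; unfold upd.
      destruct (key_eqb_spec k k'); [lia | auto].
  - rewrite <- geo_linear. apply geo_ext; intros s. apply IH; auto.
    destruct Hin; congruence.
Qed.

End Environment.

(* [col_time r W prev j] is the time packet [j] leaves a link whose receiver
   already holds [r] packets, when packet [j] arrives at time [prev j] and needs
   [W j] attempts. *)
Fixpoint col_time (r : nat) (W prev : nat -> nat) (j : nat) : nat :=
  match j with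
  | O => O
  | S j' => if (j <=? r)%nat then O
            else (Nat.max (prev j) (col_time r W prev j') + W j)%nat
  end.

Fixpoint lpp (rs : list nat) (i : nat) (W : nat -> nat -> nat) (prev : nat -> nat) : nat -> nat :=
  match rs with
  | [] => prev
  | r :: rs' => lpp rs' (S i) W (col_time r (W i) prev)
  end.

Lemma col_time_ext (r : nat) (W W' prev prev' : nat -> nat) (j : nat) :
  (forall i, (i <= j)%nat -> W i = W' i) ->
  (forall i, (i <= j)%nat -> prev i = prev' i) ->
  col_time r W prev j = col_time r W' prev' j.
Proof.
  induction j as [|j IH]; intros HW Hp; auto. cbn [col_time].
  rewrite IH by auto. rewrite HW, Hp by auto. reflexivity.
Qed.

Lemma lpp_ext (rs : list nat) (i n : nat) (W W' : nat -> nat -> nat) (prev prev' : nat -> nat) :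
  (forall i' j, (i <= i')%nat -> (j <= n)%nat -> W i' j = W' i' j) ->
  (forall j, (j <= n)%nat -> prev j = prev' j) ->
  forall j, (j <= n)%nat -> lpp rs i W prev j = lpp rs i W' prev' j.
Proof.
  revert i prev prev'; induction rs as [|r rs IH]; intros i prev prev' HW Hp j Hj; simpl; auto.
  apply IH; auto.
  - intros i' j' Hi Hj'; apply HW; lia.
  - intros j' Hj'. apply col_time_ext; intros j2 Hj2; [apply HW | apply Hp]; lia.
Qed.

Lemma col_time_capped (T r : nat) (W W' prev prev' : nat -> nat) (j : nat) :
  (forall j, Nat.min (W j) T = Nat.min (W' j) T) ->
  (forall j, Nat.min (prev j) T = Nat.min (prev' j) T) ->
  Nat.min (col_time r W prev j) T = Nat.min (col_time r W' prev' j) T.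
Proof.
  intros HW Hp; induction j as [|j IH]; auto. cbn [col_time].
  destruct (S j <=? r)%nat; auto.
  specialize (HW (S j)). specialize (Hp (S j)). lia.
Qed.

Lemma lpp_capped (T : nat) (rs : list nat) (i : nat) (W W' : nat -> nat -> nat)
    (prev prev' : nat -> nat) (j : nat) :
  (forall i j, Nat.min (W i j) T = Nat.min (W' i j) T) ->
  (forall j, Nat.min (prev j) T = Nat.min (prev' j) T) ->
  Nat.min (lpp rs i W prev j) T = Nat.min (lpp rs i W' prev' j) T.
Proof.
  intros HW; revert i prev prev'; induction rs as [|r rs IH]; intros i prev prev' Hp; simpl; auto.
  apply IH. intros j'; apply col_time_capped; auto.
Qed.

Lemma last_cons {A : Type} (r d : A) (rs : list A) : last (r :: rs) d = last rs r.
Proof.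
  revert r d; induction rs as [|a rs IH]; intros r d; auto.
  change (last (a :: rs) d = last (a :: rs) r). rewrite !IH. reflexivity.
Qed.

Section Law.
Context (q : key -> R) (K : nat) (kappa : nat -> nat -> key) (pcol : nat -> R)
  (ks : list key) (n l : nat) (w0 : key -> nat).
Hypothesis kappa_inj : forall i j i' j', kappa i j = kappa i' j' -> i = i' /\ j = j'.
Hypothesis Hnd : NoDup ks.
Hypothesis Hks : forall i j, (1 <= i <= l)%nat -> (1 <= j <= n)%nat -> In (kappa i j) ks.
Hypothesis Hq : forall i j, (1 <= i <= l)%nat -> (1 <= j <= n)%nat -> q (kappa i j) = pcol i.

Let Wt (w : key -> nat) : nat -> nat -> nat := fun i j => w (kappa i j).

Lemma lpp_upd (rs : list nat) (i i0 j0 s : nat) (w : key -> nat) (prev : nat -> nat) (j : nat) :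
  (i0 < i)%nat -> lpp rs i (Wt (upd w (kappa i0 j0) s)) prev j = lpp rs i (Wt w) prev j.
Proof.
  intros H. apply (lpp_ext rs i j); auto. intros i' j' Hi _. unfold Wt.
  apply upd_other. intros E; apply kappa_inj in E; lia.
Qed.

(* [A] and [B] are the arrival times before and after one time step, for a node
   that already holds [up] packets. *)
Definition one_step (up : nat) (A B : (key -> nat) -> nat -> nat) : Prop :=
  forall w j, (j <= n)%nat ->
    if (j <=? up)%nat then A w j = O /\ B w j = O else A w j = S (B w j).

Definition indep_from (i : nat) (A : (key -> nat) -> nat -> nat) : Prop :=
  forall w i' j' s j, (i <= i')%nat -> A (upd w (kappa i' j') s) j = A w j.

Definition capped_col (T : nat) (A : (key -> nat) -> nat -> nat) : Prop :=
  forall w w', (forall k, Nat.min (w k) T = Nat.min (w' k) T) ->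
    forall j, Nat.min (A w j) T = Nat.min (A w' j) T.

(** The first time step is revealed link by link. An active link tries its next packet [S r], and
    [envE_memoryless] splits on the outcome; an idle link reveals nothing. Either way the remaining
    weights keep their law, and every passage time still pending drops by one. *)
Lemma lpp_step (tau len : nat) : (tau <= K)%nat ->
  forall rs i up A B, length rs = len -> (1 <= i)%nat -> (i + len = S l)%nat ->
  Forall (fun r => (r <= n)%nat) rs -> (up <= n)%nat ->
  one_step up A B -> indep_from i A -> indep_from i B -> capped_col (S tau) A ->
  envE q K ks (fun w => INR (Nat.min (lpp rs i (Wt w) (A w) n) (S tau))) w0
  = (if (last rs up <? n)%nat then 1 else 0)
    + step_exp (map pcol (seq i len)) rs up
        (fun v => envE q K ks (fun w => INR (Nat.min (lpp v i (Wt w) (B w) n) tau)) w0).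
Proof.
  intros HT. induction len as [|len IH];
    intros [|r rs] i up A B Hlen Hi Hil Hrs Hup H1 HA HB HC; try discriminate.
  - cbn [last lpp map seq step_exp].
    destruct (Nat.ltb_spec up n) as [Hlt|Hge].
    + rewrite (envE_ext _ _ _ _ (fun w => 1 * 1 + 1 * INR (Nat.min (B w n) tau))).
      * rewrite envE_linear, envE_const. ring.
      * intros w. specialize (H1 w n (le_n n)).
        destruct (Nat.leb_spec n up); [lia|]. rewrite H1.
        change (Nat.min (S (B w n)) (S tau)) with (S (Nat.min (B w n) tau)).
        rewrite S_INR. ring.
    + rewrite (envE_ext _ _ _ _ (fun w => INR (Nat.min (B w n) tau))); [ring|].
      intros w. specialize (H1 w n (le_n n)).
      destruct (Nat.leb_spec n up); [|lia]. destruct H1 as [-> ->]. reflexivity.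
  - injection Hlen as Hlen. inversion Hrs as [|? ? Hr Hrs']; subst.
    rewrite last_cons. cbn [seq map step_exp].
    destruct (Nat.ltb_spec r up) as [Hlt|Hge].
    + set (k := kappa i (S r)).
      rewrite (envE_memoryless q K (S tau) ks _ k w0); auto; try lia.
      2: { apply Hks; lia. }
      2: { intros w w' Hw. f_equal. apply lpp_capped; auto. intros; apply Hw. }
      replace (q k) with (pcol i) by (symmetry; apply Hq; lia).
      (* [A1], [B1] describe success: packet [S r] needs one step, after which the receiver holds
         [S r] packets. [A2], [B2] describe failure: one attempt is used up and the receiver stays
         at [r]. *)
      set (A1 := fun w => col_time r (Wt (upd w k 1) i) (A w)).
      set (A2 := fun w => col_time r (Wt (upd w k (S (w k))) i) (A w)).
      set (B1 := fun w => col_time (S r) (Wt w i) (B w)).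
      set (B2 := fun w => col_time r (Wt w i) (B w)).
      assert (Hk : forall j w s, j <> S r -> Wt (upd w k s) i j = Wt w i j).
      { intros j w s Hj. unfold Wt. apply upd_other. unfold k.
        intros E; apply kappa_inj in E; lia. }
      assert (Hk1 : forall w s, Wt (upd w k s) i (S r) = s).
      { intros w s. apply upd_same. }
      rewrite (envE_ext _ _ _ (fun v => INR (Nat.min (lpp (r :: rs) i
          (Wt (upd v k 1)) (A (upd v k 1)) n) (S tau)))
        (fun w => INR (Nat.min (lpp rs (S i) (Wt w) (A1 w) n) (S tau)))).
      2: { intros w. cbn [lpp]. unfold k at 1. rewrite lpp_upd by lia.
           do 2 f_equal. apply (lpp_ext rs (S i) n); auto.
           intros j Hj. apply col_time_ext; auto. intros; apply HA; lia. }
      rewrite (envE_ext _ _ _ (fun v => INR (Nat.min (lpp (r :: rs) i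
          (Wt (upd v k (S (v k)))) (A (upd v k (S (v k)))) n) (S tau)))
        (fun w => INR (Nat.min (lpp rs (S i) (Wt w) (A2 w) n) (S tau)))).
      2: { intros w. cbn [lpp]. unfold k at 1. rewrite lpp_upd by lia.
           do 2 f_equal. apply (lpp_ext rs (S i) n); auto.
           intros j Hj. apply col_time_ext; auto. intros; apply HA; lia. }
      rewrite (IH rs (S i) r A1 B1), (IH rs (S i) r A2 B2); auto; try lia.
      * cbn [lpp]. unfold B1, B2. ring.
      * intros w j Hj. unfold A2, B2. induction j as [|j IHj]; [split; auto|].
        specialize (IHj ltac:(lia)). cbn [col_time].
        pose proof (H1 w (S j) Hj) as Hj1.
        destruct (Nat.leb_spec (S j) r); auto.
        destruct (Nat.eq_dec j r) as [->|Hne].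
        -- rewrite Hk1. destruct (Nat.leb_spec r r); [|lia].
           destruct (Nat.leb_spec (S r) up); [|lia].
           change (Wt w i (S r)) with (w k). lia.
        -- rewrite Hk by lia. destruct (Nat.leb_spec j r); [lia|].
           destruct (Nat.leb_spec (S j) up); lia.
      * intros w i' j' s j Hi'. unfold A2. apply col_time_ext; intros j2 _.
        -- unfold k. unfold Wt. rewrite (upd_other w).
           ++ destruct (key_eqb_spec (kappa i (S r)) (kappa i j2)) as [<-|Hne].
              ** rewrite !upd_same; auto.
              ** rewrite !upd_other; auto. intros E; apply kappa_inj in E; lia.
           ++ intros E; apply kappa_inj in E; lia.
        -- apply HA; lia.
      * intros w i' j' s j Hi'. unfold B2. apply col_time_ext; intros j2 _.
        -- unfold Wt. apply upd_other. intros E; apply kappa_inj in E; lia.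
        -- apply HB; lia.
      * intros w w' Hw j. unfold A2. apply col_time_capped; [|apply HC; auto].
        intros j'. unfold Wt, upd. pose proof (Hw k). destruct (key_eqb_spec k (kappa i j')); auto; lia.
      * intros w j Hj. unfold A1, B1. induction j as [|j IHj]; [split; auto|].
        specialize (IHj ltac:(lia)). cbn [col_time].
        pose proof (H1 w (S j) Hj) as Hj1.
        destruct (Nat.leb_spec (S j) r), (Nat.leb_spec (S j) (S r)); auto; try lia.
        ++ assert (j = r) as -> by lia.
           rewrite Hk1. destruct (Nat.leb_spec r r); [|lia].
           destruct (Nat.leb_spec (S r) up); [|lia]. lia.
        ++ rewrite Hk by lia. destruct (Nat.leb_spec j r); [lia|].
           destruct (Nat.leb_spec (S j) up); lia.
      * intros w i' j' s j Hi'. unfold A1. apply col_time_ext; intros j2 _.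
        -- unfold Wt, k.
           destruct (key_eqb_spec (kappa i (S r)) (kappa i j2)) as [<-|Hne].
           ++ rewrite !upd_same; auto.
           ++ rewrite !upd_other; auto. intros E; apply kappa_inj in E; lia.
        -- apply HA; lia.
      * intros w i' j' s j Hi'. unfold B1. apply col_time_ext; intros j2 _.
        -- unfold Wt. apply upd_other. intros E; apply kappa_inj in E; lia.
        -- apply HB; lia.
      * intros w w' Hw j. unfold A1. apply col_time_capped; [|apply HC; auto].
        intros j'. unfold Wt, upd. destruct (key_eqb_spec k (kappa i j')); auto.
    (* Idle link: each packet above [r] is also above [up], so it arrives one step later in [A] than
       in [B] and leaves one step later too. *)
    + cbn [lpp]. apply IH; auto; try lia.
      * intros w j Hj. induction j as [|j IHj]; [split; auto|].
        specialize (IHj ltac:(lia)). cbn [col_time].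
        pose proof (H1 w (S j) Hj) as Hj1.
        destruct (Nat.leb_spec (S j) r); auto.
        destruct (Nat.leb_spec (S j) up); [lia|].
        destruct (Nat.leb_spec j r); lia.
      * intros w i' j' s j Hi'. apply col_time_ext; intros j2 _.
        -- unfold Wt. apply upd_other. intros E; apply kappa_inj in E; lia.
        -- apply HA; lia.
      * intros w i' j' s j Hi'. apply col_time_ext; intros j2 _.
        -- unfold Wt. apply upd_other. intros E; apply kappa_inj in E; lia.
        -- apply HB; lia.
      * intros w w' Hw j. apply col_time_capped; [|apply HC; auto].
        intros j'. apply Hw.
Qed.

(* The weights may sit at any injective family of keys, which makes equalities
   in law under shifts and reversals of the grid automatic. *)
Lemma mean_time_lpp (tau : nat) (rs : list nat) :
  (tau <= S K)%nat -> length rs = l -> Forall (fun r => (r <= n)%nat) rs ->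
  envE q K ks (fun w => INR (Nat.min (lpp rs 1 (Wt w) (fun _ => O) n) tau)) w0
  = mean_time (map pcol (seq 1 l)) n tau rs.
Proof.
  revert rs; induction tau as [|tau IH]; intros rs HT Hl Hrs.
  - rewrite (envE_ext _ _ _ _ (fun _ => 0)), envE_const; auto.
    intros w. rewrite Nat.min_0_r; auto.
  - rewrite (lpp_step tau l ltac:(lia) rs 1 n (fun _ _ => O) (fun _ _ => O)); auto; try lia.
    + cbn [mean_time]. f_equal. apply (step_exp_ext _ _ _ n); auto.
      * rewrite length_map, length_seq; auto.
      * intros v Hv1 Hv2. apply IH; auto; lia.
    + intros w j Hj. destruct (Nat.leb_spec j n); auto; lia.
    + intros ? ? ? ? ? ?; auto.
    + intros ? ? ? ? ? ?; auto.
    + intros ? ? ? ?; auto.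
Qed.

End Law.

(** * Crossing paths *)

Fixpoint passage (W : nat -> nat -> nat) (i : nat) : nat -> nat :=
  match i with
  | O => fun _ => O
  | S i' => col_time O (W i) (passage W i')
  end.

Lemma passage_S (W : nat -> nat -> nat) (i j : nat) :
  passage W (S i) (S j)
  = (Nat.max (passage W i (S j)) (passage W (S i) j) + W (S i) (S j))%nat.
Proof. reflexivity. Qed.

Lemma passage_0 (W : nat -> nat -> nat) (i : nat) : passage W i O = O.
Proof. destruct i; reflexivity. Qed.

Lemma lpp_passage (W : nat -> nat -> nat) (l i : nat) :
  lpp (repeat O l) (S i) W (passage W i) = passage W (i + l).
Proof.
  revert i; induction l as [|l IH]; intros i; simpl.
  - rewrite Nat.add_0_r; auto.
  - rewrite Nat.add_succ_r. apply (IH (S i)).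
Qed.

Lemma passage_mono_packet (W : nat -> nat -> nat) (i j j' : nat) :
  (j <= j')%nat -> (passage W i j <= passage W i j')%nat.
Proof.
  induction 1; auto. destruct i; [auto|]. rewrite passage_S. lia.
Qed.

Lemma passage_mono_server (W : nat -> nat -> nat) (i i' j : nat) :
  (i <= i')%nat -> (passage W i j <= passage W i' j)%nat.
Proof.
  induction 1; auto. destruct j; [rewrite !passage_0; auto|]. rewrite passage_S. lia.
Qed.

(** [passage W' i j] is the best path from packet [2] to packet [j + 1]. The path from packet [1] to
    [j + 2] must cross it; exchanging tails at the crossing gives paths from [1] to [j + 1] and from
    [2] to [j + 2]. *)
Lemma passage_monge (W W' : nat -> nat -> nat) (i : nat) :
  (forall i j, W' i j = W i (S j)) ->
  (forall j, passage W' i j <= passage W i (S j))%nat /\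
  (forall j, passage W i (S (S j)) + passage W' i j
             <= passage W i (S j) + passage W' i (S j))%nat.
Proof.
  intros HW; induction i as [|i [IH1 IH2]]; [simpl; split; intros; lia|].
  assert (H1 : forall j, (passage W' (S i) j <= passage W (S i) (S j))%nat).
  { induction j as [|j IHj]; [rewrite passage_0; lia|].
    rewrite (passage_S W'), (passage_S W), HW. specialize (IH1 (S j)). lia. }
  split; auto.
  (* The crossing argument in local form: increments across a link and increments across a packet
     are compared together, by induction on [j]. *)
  assert (H : forall j,
    (passage W i (S j) + passage W' (S i) j <= passage W (S i) (S j) + passage W' i j
     /\ passage W (S i) (S (S j)) + passage W' (S i) j
        <= passage W (S i) (S j) + passage W' (S i) (S j))%nat).
  { induction j as [|j [IHa IHb]].
    - rewrite !(passage_S W), (passage_S W'), !passage_0, HW.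
      specialize (IH2 O). rewrite passage_0 in IH2. lia.
    - pose proof (IH2 j) as Ia. pose proof (IH2 (S j)) as Ib.
      rewrite (passage_S W i (S (S j))), (passage_S W' i (S j)), HW.
      rewrite (passage_S W i (S j)), (passage_S W' i j), HW in *. lia. }
  apply H.
Qed.

(** A path through all the links must meet row [m + 1], all of whose first [j] cells are used by
    [passage W' 1 j]. Exchanging tails where they meet gives a path starting in that row and a path
    ending in it. *)
Lemma passage_split (W W' : nat -> nat -> nat) (m i : nat) :
  (forall i j, W' i j = W (m + i)%nat j) ->
  (forall j, passage W' i j <= passage W (m + i) j)%nat /\
  (forall j, passage W (m + S i) j + passage W' 1 j
             <= passage W' (S i) j + passage W (m + 1) j)%nat.
Proof.
  intros HW.
  assert (H1 : forall i j, (passage W' i j <= passage W (m + i) j)%nat).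
  { clear i; intros i; induction i as [|i IHi]; [simpl; lia|].
    rewrite Nat.add_succ_r. induction j as [|j IHj]; [rewrite passage_0; lia|].
    rewrite (passage_S W'), (passage_S W), HW, Nat.add_succ_r. specialize (IHi (S j)). lia. }
  split; auto. clear H1.
  (* One more packet adds exactly its own weight to the single row, and at least that weight to any
     passage time ending in that row. *)
  assert (Hm : forall j, (passage W (m + 1) j + passage W' 1 (S j)
                          <= passage W (m + 1) (S j) + passage W' 1 j)%nat).
  { intros j. rewrite Nat.add_1_r, (passage_S W), (passage_S W'), HW, Nat.add_1_r.
    simpl. lia. }
  induction i as [|i IHi]; [lia|].
  induction j as [|j IHj]; [rewrite !passage_0; lia|].
  specialize (IHi (S j)). specialize (Hm j).
  rewrite (passage_S W' (S i)), HW. rewrite !Nat.add_succ_r in *.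
  rewrite (passage_S W (S (m + i))). lia.
Qed.

(* [W'] is [W] read backwards; for i, j in range,
   [passage W i j + max (passage W' (l-i) (n+1-j)) (passage W' (l+1-i) (n-j))]
   is the best path through the cell (i, j), hence at most the optimum of [W']. *)
Lemma passage_reverse (W W' : nat -> nat -> nat) (l n : nat) :
  (forall i j, (1 <= i <= l)%nat -> (1 <= j <= n)%nat ->
     W' (S l - i)%nat (S n - j)%nat = W i j) ->
  (passage W l n <= passage W' l n)%nat.
Proof.
  intros HW.
  assert (E : forall i j, (1 <= i <= l)%nat -> (1 <= j <= n)%nat ->
    passage W' (S l - i) (S n - j)
    = (Nat.max (passage W' (l - i) (S n - j)) (passage W' (S l - i) (n - j)) + W i j)%nat).
  { intros i j Hi Hj.
    pose proof (HW i j Hi Hj) as E.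
    replace (S l - i)%nat with (S (l - i)) in * by lia.
    replace (S n - j)%nat with (S (n - j)) in * by lia.
    rewrite passage_S. lia. }
  assert (H : forall i j, (i <= l)%nat -> (j <= n)%nat ->
    (i = O -> passage W i j = O) /\
    (1 <= i -> 1 <= j ->
     passage W i j + Nat.max (passage W' (l - i) (S n - j)) (passage W' (S l - i) (n - j))
     <= passage W' l n)%nat).
  { induction i as [|i IHi]; [split; [auto|lia]|].
    induction j as [|j IHj]; intros Hi Hj; split; try lia; intros _ _.
    rewrite passage_S. specialize (E (S i) (S j) ltac:(lia) ltac:(lia)).
    assert (Ha : (passage W i (S j) + passage W' (S l - S i) (S n - S j) <= passage W' l n)%nat).
    { destruct i as [|i].
      - simpl passage at 1. simpl Nat.sub. rewrite Nat.sub_0_r.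
        apply passage_mono_packet; lia.
      - destruct (IHi (S j) ltac:(lia) Hj) as [_ Hx]. specialize (Hx ltac:(lia) ltac:(lia)).
        replace (S l - S (S i))%nat with (l - S i)%nat by lia. lia. }
    assert (Hb : (passage W (S i) j + passage W' (S l - S i) (S n - S j) <= passage W' l n)%nat).
    { destruct j as [|j].
      - rewrite passage_0. apply Nat.le_trans with (passage W' l (S n - 1)).
        + apply passage_mono_server; lia.
        + apply passage_mono_packet; lia.
      - destruct (IHj ltac:(lia) ltac:(lia)) as [_ Hx]. specialize (Hx ltac:(lia) ltac:(lia)).
        replace (S n - S (S j))%nat with (n - S j)%nat by lia. lia. }
    lia. }
  destruct l as [|l]; [simpl; lia|]. destruct n as [|n]; [rewrite passage_0; lia|].
  destruct (H (S l) (S n)) as [_ Hx]; lia.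
Qed.

(** * Averages of passage times over a common grid of weights *)

Definition key_dec (k k' : key) : {k = k'} + {k <> k'}.
Proof. decide equality; apply Z.eq_dec. Defined.

Definition grid (l n : nat) : list key :=
  nodup key_dec (list_prod (map Z.of_nat (seq 1 l)) (map Z.of_nat (seq 1 n))).

Lemma in_grid (l n : nat) (a b : Z) :
  In (a, b) (grid l n) <-> (1 <= a <= Z.of_nat l)%Z /\ (1 <= b <= Z.of_nat n)%Z.
Proof.
  unfold grid. rewrite nodup_In, in_prod_iff, !in_map_iff. split.
  - intros [[x [<- Hx]] [y [<- Hy]]]. rewrite in_seq in Hx, Hy. lia.
  - intros [Ha Hb]; split; [exists (Z.to_nat a) | exists (Z.to_nat b)]; rewrite in_seq; lia.
Qed.

Section Laws.
Context (p : nat -> R) (L N tau : nat).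
Hypothesis Hp : forall i, (1 <= i <= L)%nat -> is_prob (p i).

Definition grid_mean (f : (key -> nat) -> nat) : R :=
  envE (fun k => p (Z.to_nat (fst k))) tau (grid L N)
    (fun w => INR (Nat.min (f w) tau)) (fun _ => O).

(** This is the coupling device: the networks to be compared are all read off one family of weights
    through different [kappa], so that pathwise inequalities can be averaged. *)
Lemma grid_mean_passage (kappa : nat -> nat -> key) (l n : nat) (pcol : nat -> R) :
  (forall i j i' j', kappa i j = kappa i' j' -> i = i' /\ j = j') ->
  (forall i j, (1 <= i <= l)%nat -> (1 <= j <= n)%nat ->
     In (kappa i j) (grid L N) /\ p (Z.to_nat (fst (kappa i j))) = pcol i) ->
  grid_mean (fun w => passage (fun i j => w (kappa i j)) l n)
  = mean_time (map pcol (seq 1 l)) n tau (repeat O l).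
Proof.
  intros Hinj Hk. unfold grid_mean.
  rewrite <- (mean_time_lpp (fun k => p (Z.to_nat (fst k))) tau kappa pcol
     (grid L N) n l (fun _ => O)); auto.
  - apply envE_ext. intros w. do 2 f_equal.
    symmetry. apply (f_equal (fun g => g n) (lpp_passage (fun i j => w (kappa i j)) l O)).
  - apply NoDup_nodup.
  - apply Hk.
  - apply Hk.
  - apply repeat_length.
  - apply Forall_forall. intros x Hx. apply repeat_spec in Hx. lia.
Qed.

Lemma grid_mean_le (f g : (key -> nat) -> nat) :
  (forall w, (f w <= g w)%nat) -> grid_mean f <= grid_mean g.
Proof.
  intros H. apply envE_le.
  - intros [a b] Hk. apply in_grid in Hk. apply Hp. simpl. lia.
  - intros w. apply le_INR. specialize (H w). lia.
Qed.

(* The hypotheses survive the truncation at [tau]. *)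
Lemma grid_mean_submodular (x u v y : (key -> nat) -> nat) :
  (forall w, u w <= x w /\ v w <= x w /\ y w <= u w /\ y w <= v w
             /\ x w + y w <= u w + v w)%nat ->
  grid_mean x + grid_mean y <= grid_mean u + grid_mean v.
Proof.
  intros H. unfold grid_mean.
  assert (E : forall a b : (key -> nat) -> nat, grid_mean a + grid_mean b
    = envE (fun k => p (Z.to_nat (fst k))) tau (grid L N)
       (fun w => 1 * INR (Nat.min (a w) tau) + 1 * INR (Nat.min (b w) tau)) (fun _ => O)).
  { intros a b. rewrite envE_linear. unfold grid_mean. ring. }
  fold (grid_mean x) (grid_mean y) (grid_mean u) (grid_mean v). rewrite !E. apply envE_le.
  - intros [a b] Hk. apply in_grid in Hk. apply Hp. simpl. lia.
  - intros w. rewrite !Rmult_1_l, <- !plus_INR. apply le_INR. specialize (H w). lia.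
Qed.

End Laws.

Definition mean_passage (ps : list R) (n tau : nat) : R :=
  mean_time ps n tau (repeat O (length ps)).

Lemma mean_passage_map (pcol : nat -> R) (l n tau : nat) :
  mean_passage (map pcol (seq 1 l)) n tau
  = mean_time (map pcol (seq 1 l)) n tau (repeat O l).
Proof. unfold mean_passage. rewrite length_map, length_seq. auto. Qed.

Lemma mean_passage_concave (p : nat -> R) (l n tau : nat) :
  (forall i, (1 <= i <= l)%nat -> is_prob (p i)) ->
  mean_passage (map p (seq 1 l)) (S (S n)) tau + mean_passage (map p (seq 1 l)) n tau
  <= mean_passage (map p (seq 1 l)) (S n) tau + mean_passage (map p (seq 1 l)) (S n) tau.
Proof.
  intros Hp. rewrite !mean_passage_map.
  set (k0 := fun i j : nat => (Z.of_nat i, Z.of_nat j)).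
  set (k1 := fun i j : nat => (Z.of_nat i, Z.of_nat (S j))).
  rewrite <- (grid_mean_passage p l (S (S n)) tau k0 l (S (S n)) p).
  rewrite <- (grid_mean_passage p l (S (S n)) tau k1 l n p).
  (* The two equal means for [S n] packets are realised differently: one starts at packet [1], the
     other at packet [2]. *)
  rewrite <- (grid_mean_passage p l (S (S n)) tau k0 l (S n) p) at 1.
  rewrite <- (grid_mean_passage p l (S (S n)) tau k1 l (S n) p).
  2-9: unfold k0, k1; first [intros ? ? ? ? E; apply pair_equal_spec in E; lia
    | intros; rewrite in_grid; cbn [fst]; split; [lia | f_equal; lia]].
  apply grid_mean_submodular; auto. intros w.
  destruct (passage_monge (fun i j => w (k0 i j)) (fun i j => w (k1 i j)) l) as [H1 H2]; auto.
  specialize (H2 n). pose proof (H1 n). pose proof (H1 (S n)).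
  pose proof (passage_mono_packet (fun i j => w (k0 i j)) l (S n) (S (S n)) ltac:(lia)).
  pose proof (passage_mono_packet (fun i j => w (k1 i j)) l n (S n) ltac:(lia)).
  lia.
Qed.

Lemma mean_passage_split (p : nat -> R) (a b n tau : nat) :
  (forall i, (1 <= i <= a + S b)%nat -> is_prob (p i)) ->
  mean_passage (map p (seq 1 (a + S b))) n tau + mean_passage [p (S a)] n tau
  <= mean_passage (map (fun i => p (a + i)%nat) (seq 1 (S b))) n tau
     + mean_passage (map p (seq 1 (S a))) n tau.
Proof.
  intros Hp.
  change [p (S a)] with (map (fun _ : nat => p (S a)) (seq 1 1)).
  rewrite !mean_passage_map.
  set (k0 := fun i j : nat => (Z.of_nat i, Z.of_nat j)).
  set (k1 := fun i j : nat => (Z.of_nat (a + i), Z.of_nat j)).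
  rewrite <- (grid_mean_passage p (a + S b) n tau k0 (a + S b) n p).
  rewrite <- (grid_mean_passage p (a + S b) n tau k1 1 n (fun _ => p (S a))).
  rewrite <- (grid_mean_passage p (a + S b) n tau k1 (S b) n (fun i => p (a + i)%nat)).
  rewrite <- (grid_mean_passage p (a + S b) n tau k0 (S a) n p).
  2-9: unfold k0, k1; first [intros ? ? ? ? E; apply pair_equal_spec in E; lia
    | intros; rewrite in_grid; cbn [fst]; split; [lia | f_equal; lia]].
  apply grid_mean_submodular; auto. intros w.
  set (W := fun i j => w (k0 i j)). set (W' := fun i j => w (k1 i j)).
  assert (HW : forall i j, W' i j = W (a + i)%nat j) by reflexivity.
  destruct (passage_split W W' a (S b) HW) as [H1 _].
  destruct (passage_split W W' a b HW) as [_ H2].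
  destruct (passage_split W W' a 1 HW) as [H3 _].
  specialize (H1 n). specialize (H2 n). specialize (H3 n). rewrite Nat.add_1_r in *.
  pose proof (passage_mono_server W (S a) (a + S b) n ltac:(lia)).
  pose proof (passage_mono_server W' 1 (S b) n ltac:(lia)).
  lia.
Qed.

Lemma mean_passage_reverse (p : nat -> R) (l n tau : nat) :
  (forall i, (1 <= i <= l)%nat -> is_prob (p i)) ->
  mean_passage (map p (seq 1 l)) n tau
  <= mean_passage (map (fun i => p (S l - i)%nat) (seq 1 l)) n tau.
Proof.
  intros Hp. rewrite !mean_passage_map.
  set (k0 := fun i j : nat => (Z.of_nat i, Z.of_nat j)).
  set (k1 := fun i j : nat => (Z.of_nat (S l) - Z.of_nat i, Z.of_nat (S n) - Z.of_nat j)%Z).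
  rewrite <- (grid_mean_passage p l n tau k0 l n p).
  rewrite <- (grid_mean_passage p l n tau k1 l n (fun i => p (S l - i)%nat)).
  2-5: unfold k0, k1; first [intros ? ? ? ? E; apply pair_equal_spec in E; lia
    | intros; rewrite in_grid; cbn [fst]; split; [lia | f_equal; lia]].
  apply grid_mean_le; auto. intros w.
  apply passage_reverse. intros i j Hi Hj. unfold k0, k1. do 2 f_equal; lia.
Qed.

(** Paths that stay in row [S a] are among those maximised over by the whole network. *)
Lemma mean_passage_server (p : nat -> R) (a b n tau : nat) :
  (forall i, (1 <= i <= a + S b)%nat -> is_prob (p i)) ->
  mean_passage [p (S a)] n tau <= mean_passage (map p (seq 1 (a + S b))) n tau.
Proof.
  intros Hp.
  change [p (S a)] with (map (fun _ : nat => p (S a)) (seq 1 1)).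
  rewrite !mean_passage_map.
  set (k0 := fun i j : nat => (Z.of_nat i, Z.of_nat j)).
  set (k1 := fun i j : nat => (Z.of_nat (a + i), Z.of_nat j)).
  rewrite <- (grid_mean_passage p (a + S b) n tau k0 (a + S b) n p).
  rewrite <- (grid_mean_passage p (a + S b) n tau k1 1 n (fun _ => p (S a))).
  2-5: unfold k0, k1; first [intros ? ? ? ? E; apply pair_equal_spec in E; lia
    | intros; rewrite in_grid; cbn [fst]; split; [lia | f_equal; lia]].
  apply grid_mean_le; auto. intros w.
  set (W := fun i j => w (k0 i j)). set (W' := fun i j => w (k1 i j)).
  destruct (passage_split W W' a 1) as [H3 _]; [reflexivity|].
  specialize (H3 n).
  pose proof (passage_mono_server W (a + 1) (a + S b) n ltac:(lia)). lia.
Qed.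

(** * Link configurations *)

Definition lsum {A : Type} (f : A -> R) (xs : list A) : R := fold_right Rplus 0 (map f xs).

Lemma lsum_app {A : Type} (f : A -> R) (xs ys : list A) :
  lsum f (xs ++ ys) = lsum f xs + lsum f ys.
Proof. unfold lsum; induction xs as [|x xs IH]; simpl; rewrite ?IH; ring. Qed.

Lemma lsum_flat_map {A B : Type} (f : B -> R) (g : A -> list B) (xs : list A) :
  lsum f (flat_map g xs) = lsum (fun x => lsum f (g x)) xs.
Proof.
  induction xs as [|x xs IH]; auto. simpl. rewrite lsum_app, IH. reflexivity.
Qed.

Lemma lsum_map {A B : Type} (f : B -> R) (g : A -> B) (xs : list A) :
  lsum f (map g xs) = lsum (fun x => f (g x)) xs.
Proof. unfold lsum. rewrite map_map. auto. Qed.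

Lemma lsum_ext {A : Type} (f g : A -> R) (xs : list A) :
  (forall x, In x xs -> f x = g x) -> lsum f xs = lsum g xs.
Proof. intros H. unfold lsum. rewrite (map_ext_in f g xs); auto. Qed.

Lemma lsum_linear {A : Type} (a b : R) (f g : A -> R) (xs : list A) :
  lsum (fun x => a * f x + b * g x) xs = a * lsum f xs + b * lsum g xs.
Proof. unfold lsum; induction xs as [|x xs IH]; simpl; rewrite ?IH; ring. Qed.

Lemma lsum_scal {A : Type} (a : R) (f : A -> R) (xs : list A) :
  lsum (fun x => a * f x) xs = a * lsum f xs.
Proof. unfold lsum; induction xs as [|x xs IH]; simpl; rewrite ?IH; ring. Qed.

Lemma lsum_nonneg {A : Type} (f : A -> R) (xs : list A) :
  (forall x, In x xs -> 0 <= f x) -> 0 <= lsum f xs.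
Proof.
  unfold lsum; induction xs as [|x xs IH]; simpl; intros H; [lra|].
  pose proof (H x (or_introl eq_refl)). specialize (IH (fun y Hy => H y (or_intror Hy))). lra.
Qed.

Lemma lsum_seq_reverse (f : nat -> R) (a : nat) :
  lsum (fun i => f (S (S a) - i)%nat) (seq 2 a) = lsum f (seq 1 a).
Proof.
  induction a as [|a IH]; auto.
  rewrite (seq_S a 1), lsum_app, <- IH.
  cbn [seq]. rewrite <- seq_shift. unfold lsum at 1. cbn [map fold_right].
  fold (lsum (fun i => f (S (S (S a)) - i)%nat) (map S (seq 2 a))).
  rewrite lsum_map. unfold lsum at 3. simpl. ring.
Qed.

Lemma rho_source (z : onoff) (n t : nat) : rho z n t 1 = n.
Proof. destruct t; reflexivity. Qed.

Lemma rho_ext (z z' : onoff) (n t i : nat) :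
  (forall s j, (1 <= s <= t)%nat -> z s j = z' s j) -> rho z n t i = rho z' n t i.
Proof.
  revert i; induction t as [|t IH]; intros i H; auto. simpl.
  rewrite (IH i), (IH (i - 1)%nat), (H (S t)) by (intros; try apply H; lia). reflexivity.
Qed.

Lemma rho_bound (z : onoff) (n t i : nat) : (rho z n t i <= n)%nat.
Proof.
  revert i; induction t as [|t IH]; intros i; cbn [rho].
  - destruct (i =? 1)%nat; lia.
  - destruct (i =? 1)%nat; [lia|]. destruct (2 <=? i)%nat; [|lia].
    pose proof (IH i). pose proof (IH (i - 1)%nat).
    destruct (z (S t) (i - 1)%nat); cbn [andb]; [|lia].
    destruct (Nat.ltb_spec (rho z n t i) (rho z n t (i - 1))); lia.
Qed.

Lemma rho_mono (z : onoff) (n t t' i : nat) :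
  (t <= t')%nat -> (rho z n t i <= rho z n t' i)%nat.
Proof.
  induction 1 as [|t' _ IH]; auto. apply Nat.le_trans with (1 := IH). clear IH.
  pose proof (rho_bound z n t' i). cbn [rho].
  destruct (Nat.eqb_spec i 1); auto. destruct (Nat.leb_spec 2 i); [lia|].
  assert (i = O) as -> by lia. destruct t'; simpl; lia.
Qed.

Definition ranks (z : onoff) (n l t : nat) : list nat := map (rho z n t) (seq 2 l).

Fixpoint step_row (row : list bool) (rs : list nat) (up : nat) : list nat :=
  match row, rs with
  | b :: row', r :: rs' =>
      (r + (if b && (r <? up)%nat then 1 else 0))%nat :: step_row row' rs' r
  | _, _ => []
  end.

Lemma ranks_step_from (z : onoff) (n t : nat) (row : list bool) (i : nat) :
  (1 <= i)%nat -> (forall k, (k < length row)%nat -> z (S t) (i + k)%nat = nth k row false) ->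
  map (rho z n (S t)) (seq (S i) (length row))
  = step_row row (map (rho z n t) (seq (S i) (length row))) (rho z n t i).
Proof.
  revert i; induction row as [|b row IH]; intros i Hi Hz; auto.
  cbn [length seq map step_row]. f_equal.
  - cbn [rho]. destruct (Nat.eqb_spec (S i) 1); [lia|].
    destruct (Nat.leb_spec 2 (S i)); [|lia].
    replace (S i - 1)%nat with (i + 0)%nat by lia.
    rewrite (Hz O) by (simpl; lia). rewrite Nat.add_0_r. reflexivity.
  - apply IH; [lia|]. intros k Hk. specialize (Hz (S k) ltac:(simpl; lia)).
    rewrite Nat.add_succ_r in Hz. exact Hz.
Qed.

Lemma all_bits_length (l : nat) (row : list bool) : In row (all_bits l) -> length row = l.
Proof.
  revert row; induction l as [|l IH]; simpl; intros row H.
  - destruct H as [<-|[]]; auto.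
  - apply in_flat_map in H as [r [Hr [<-|[<-|[]]]]]; simpl; rewrite (IH r); auto.
Qed.

Lemma all_configs_length (l t : nat) (c : list (list bool)) :
  In c (all_configs l t) -> length c = t.
Proof.
  revert c; induction t as [|t IH]; simpl; intros c H.
  - destruct H as [<-|[]]; auto.
  - apply in_flat_map in H as [c' [Hc' H]]. apply in_map_iff in H as [row [<- _]].
    rewrite length_app, (IH c'); simpl; auto; lia.
Qed.

Lemma row_weight_nonneg (p : nat -> R) (i l : nat) (row : list bool) :
  (forall j, (i <= j < i + l)%nat -> is_prob (p j)) ->
  In row (all_bits l) -> 0 <= row_weight p i row.
Proof.
  revert i row; induction l as [|l IH]; simpl; intros i row Hp H.
  - destruct H as [<-|[]]; simpl; lra.
  - apply in_flat_map in H as [r [Hr Hin]].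
    assert (0 <= row_weight p (S i) r) by (apply IH; auto; intros; apply Hp; lia).
    destruct (Hp i ltac:(lia)).
    destruct Hin as [<-|[<-|[]]]; simpl; apply Rmult_le_pos; lra.
Qed.

Lemma config_weight_snoc (p : nat -> R) (c : list (list bool)) (row : list bool) :
  config_weight p (c ++ [row]) = config_weight p c * row_weight p 1 row.
Proof. unfold config_weight; induction c as [|r c IH]; simpl; rewrite ?IH; ring. Qed.

Lemma config_weight_nonneg (p : nat -> R) (l t : nat) (c : list (list bool)) :
  (forall j, (1 <= j <= l)%nat -> is_prob (p j)) ->
  In c (all_configs l t) -> 0 <= config_weight p c.
Proof.
  intros Hp; revert c; induction t as [|t IH]; simpl; intros c H.
  - destruct H as [<-|[]]; unfold config_weight; simpl; lra.
  - apply in_flat_map in H as [c' [Hc' H]]. apply in_map_iff in H as [row [<- Hrow]].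
    rewrite config_weight_snoc. apply Rmult_le_pos; auto.
    apply (row_weight_nonneg p 1 l); auto. intros; apply Hp; lia.
Qed.

(** For an idle link both bits lead to the same state and their weights add up to [1], which is why
    [step_exp] does not branch there. *)
Lemma all_bits_mean (p : nat -> R) (rs : list nat) (i up : nat) (f : list nat -> R) :
  lsum (fun row => row_weight p i row * f (step_row row rs up)) (all_bits (length rs))
  = step_exp (map p (seq i (length rs))) rs up f.
Proof.
  revert i up f; induction rs as [|r rs IH]; intros i up f.
  - unfold lsum; simpl; ring.
  - cbn [length all_bits seq map step_exp]. rewrite lsum_flat_map.
    destruct (Nat.ltb_spec r up) as [Hlt|Hge].
    + rewrite <- !IH, <- lsum_linear. apply lsum_ext; intros row _.
      unfold lsum; cbn [map fold_right row_weight step_row andb].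
      destruct (Nat.ltb_spec r up); [|lia].
      rewrite Nat.add_0_r, Nat.add_1_r. ring.
    + rewrite <- !IH. apply lsum_ext; intros row _.
      unfold lsum; cbn [map fold_right row_weight step_row andb].
      destruct (Nat.ltb_spec r up); [lia|].
      rewrite Nat.add_0_r. ring.
Qed.

Lemma z_of_snoc_old (c : list (list bool)) (row : list bool) (s i : nat) :
  (1 <= s <= length c)%nat -> z_of (c ++ [row]) s i = z_of c s i.
Proof. intros H. unfold z_of. rewrite app_nth1 by lia. reflexivity. Qed.

Section Configurations.
Context (l : nat) (p : nat -> R) (n : nat).

Definition rank_mean (t : nat) (f : list nat -> R) : R :=
  lsum (fun c => config_weight p c * f (ranks (z_of c) n l t)) (all_configs l t).

Lemma rank_mean_S (t : nat) (f : list nat -> R) :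
  rank_mean (S t) f = rank_mean t (fun rs => step_exp (map p (seq 1 l)) rs n f).
Proof.
  unfold rank_mean. cbn [all_configs]. rewrite lsum_flat_map.
  apply lsum_ext; intros c Hc. apply all_configs_length in Hc. rewrite lsum_map.
  assert (Hl : length (ranks (z_of c) n l t) = l)
    by (unfold ranks; rewrite length_map, length_seq; auto).
  rewrite <- Hl at 2. rewrite <- all_bits_mean, Hl, <- lsum_scal.
  apply lsum_ext; intros row Hrow. apply all_bits_length in Hrow.
  rewrite config_weight_snoc, Rmult_assoc. do 3 f_equal.
  transitivity (step_row row (ranks (z_of (c ++ [row])) n l t) n).
  - unfold ranks. rewrite <- Hrow. rewrite (ranks_step_from _ n t row 1).
    + rewrite rho_source. reflexivity.
    + lia.
    + intros k Hk. unfold z_of. rewrite app_nth2 by lia.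
      replace (S t - 1 - length c)%nat with O by lia.
      replace (1 + k - 1)%nat with k by lia. reflexivity.
  - f_equal. apply map_ext; intros i. apply rho_ext; intros s j Hs.
    apply z_of_snoc_old; lia.
Qed.

(** The last row does not affect the ranks at time [t], and its weights sum to [1]. This puts
    [tail t] and [tail (S t)] on the same configurations. *)
Lemma rank_mean_old (t : nat) (f : list nat -> R) :
  lsum (fun c => config_weight p c * f (ranks (z_of c) n l t)) (all_configs l (S t))
  = rank_mean t f.
Proof.
  unfold rank_mean. cbn [all_configs]. rewrite lsum_flat_map.
  apply lsum_ext; intros c Hc. apply all_configs_length in Hc. rewrite lsum_map.
  transitivity (config_weight p c * f (ranks (z_of c) n l t)
                * lsum (row_weight p 1) (all_bits l)).
  - rewrite <- lsum_scal. apply lsum_ext; intros row _. rewrite config_weight_snoc.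
    replace (ranks (z_of (c ++ [row])) n l t) with (ranks (z_of c) n l t); [ring|].
    apply map_ext; intros i. apply rho_ext; intros s j Hs.
    symmetry; apply z_of_snoc_old; lia.
  - replace (lsum (row_weight p 1) (all_bits l)) with 1; [ring|].
    assert (H : forall i k, lsum (row_weight p i) (all_bits k) = 1); [|auto].
    intros i k; revert i; induction k as [|k IH]; intros i.
    + unfold lsum; simpl; ring.
    + cbn [all_bits]. rewrite lsum_flat_map, <- (IH (S i)). apply lsum_ext; intros r _.
      unfold lsum; simpl; ring.
Qed.

Lemma rank_mean_linear (t : nat) (f g : list nat -> R) :
  rank_mean t (fun v => f v + g v) = rank_mean t f + rank_mean t g.
Proof.
  unfold rank_mean. rewrite <- (Rmult_1_l (lsum _ _)) at 1.
  rewrite <- lsum_scal.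
  rewrite (lsum_ext _ (fun c => 1 * (config_weight p c * f (ranks (z_of c) n l t))
                              + 1 * (config_weight p c * g (ranks (z_of c) n l t))))
    by (intros; ring).
  rewrite lsum_linear. ring.
Qed.

(** The probability that [T_n > t]. *)
Definition tail (t : nat) : R :=
  rank_mean t (fun rs => if (last rs n <? n)%nat then 1 else 0).

Lemma rank_mean_mean_time (tau t : nat) :
  rank_mean t (mean_time (map p (seq 1 l)) n (S tau))
  = tail t + rank_mean (S t) (mean_time (map p (seq 1 l)) n tau).
Proof.
  rewrite rank_mean_S. unfold tail. rewrite <- rank_mean_linear. reflexivity.
Qed.

(** The tail-sum formula for an expectation, cut at the horizon. *)
Lemma mean_passage_S (tau : nat) :
  mean_passage (map p (seq 1 l)) n (S tau) = mean_passage (map p (seq 1 l)) n tau + tail tau.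
Proof.
  assert (H0 : forall tau, mean_passage (map p (seq 1 l)) n tau
                           = rank_mean 0 (mean_time (map p (seq 1 l)) n tau)).
  { intros s. rewrite mean_passage_map. unfold rank_mean, lsum. simpl.
    replace (ranks (z_of []) n l 0) with (repeat O l); [unfold config_weight; simpl; ring|].
    unfold ranks. symmetry.
    assert (E : forall k i, (2 <= i)%nat -> map (rho (z_of []) n 0) (seq i k) = repeat O k); [|auto].
    induction k as [|k IH]; intros i Hi; auto. cbn [seq map repeat]. rewrite IH by lia.
    f_equal. simpl. destruct (Nat.eqb_spec i 1); [lia|auto]. }
  rewrite !H0.
  (* [mean_time] unfolds at the first step whereas the new term belongs to the last one, hence the
     generalisation to every starting time [t]. *)
  assert (H : forall tau t, rank_mean t (mean_time (map p (seq 1 l)) n (S tau))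
    = rank_mean t (mean_time (map p (seq 1 l)) n tau) + tail (t + tau)).
  { clear. induction tau as [|tau IH]; intros t.
    - rewrite rank_mean_mean_time, Nat.add_0_r.
      assert (E : forall t, rank_mean t (mean_time (map p (seq 1 l)) n 0) = 0).
      { intros s. unfold rank_mean. cbn [mean_time].
        rewrite (lsum_ext _ (fun c => 0 * config_weight p c)) by (intros; ring).
        rewrite lsum_scal. ring. }
      rewrite !E. ring.
    - rewrite rank_mean_mean_time, IH, (rank_mean_mean_time tau t).
      replace (t + S tau)%nat with (S t + tau)%nat by lia. ring. }
  apply (H tau O).
Qed.

Hypothesis Hl : (1 <= l)%nat.

Lemma last_ranks (z : onoff) (t : nat) : last (ranks z n l t) n = rho z n t (l + 1).
Proof.
  unfold ranks. destruct l as [|l']; [lia|].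
  rewrite seq_S, map_app. cbn [map]. rewrite last_last. f_equal. lia.
Qed.

Hypothesis Hn : (1 <= n)%nat.

Lemma tail_0 : tail 0 = 1.
Proof.
  unfold tail, rank_mean. unfold lsum; cbn [all_configs map fold_right]. rewrite last_ranks.
  unfold config_weight; simpl. destruct (Nat.eqb_spec (l + 1) 1); [lia|].
  destruct (Nat.ltb_spec 0 n); [ring|lia].
Qed.

Lemma P_Tn_eq_0 : P_Tn_eq l p n 0 = 0.
Proof.
  unfold P_Tn_eq, prob_upto, Tn_eq. simpl. destruct (Nat.eqb_spec (l + 1) 1); [lia|].
  destruct (Nat.eqb_spec 0 n); [lia|]. simpl; ring.
Qed.

(** Ranks never decrease, so the destination first reaches [n] at [S t] exactly if it is incomplete
    at [t] and complete at [S t]. *)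
Lemma Tn_eq_S (t : nat) (z : onoff) :
  (if Tn_eq l n (S t) z then 1 else 0)
  = (if (last (ranks z n l t) n <? n)%nat then 1 else 0)
    - (if (last (ranks z n l (S t)) n <? n)%nat then 1 else 0).
Proof.
  rewrite !last_ranks. unfold Tn_eq.
  pose proof (rho_mono z n t (S t) (l + 1) ltac:(lia)) as Hm.
  pose proof (rho_bound z n (S t) (l + 1)) as Hb.
  destruct (Nat.eqb_spec (rho z n (S t) (l + 1)) n) as [E|E].
  - destruct (Nat.ltb_spec (rho z n (S t) (l + 1)) n); [lia|].
    destruct (Nat.ltb_spec (rho z n t (l + 1)) n) as [Hlt|Hge].
    + replace (forallb _ _) with true; [simpl; ring|].
      symmetry. apply forallb_forall. intros s Hs. apply in_seq in Hs.
      pose proof (rho_mono z n s t (l + 1) ltac:(lia)).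
      destruct (Nat.eqb_spec (rho z n s (l + 1)) n); [lia|auto].
    + replace (forallb _ _) with false; [simpl; ring|].
      symmetry. apply not_true_iff_false. rewrite forallb_forall. intros H'.
      specialize (H' t ltac:(apply in_seq; lia)).
      destruct (Nat.eqb_spec (rho z n t (l + 1)) n); [discriminate|lia].
  - destruct (Nat.ltb_spec (rho z n (S t) (l + 1)) n); [|lia].
    destruct (Nat.ltb_spec (rho z n t (l + 1)) n); [|lia]. simpl; ring.
Qed.

Lemma P_Tn_eq_S (t : nat) : P_Tn_eq l p n (S t) = tail t - tail (S t).
Proof.
  unfold P_Tn_eq, prob_upto.
  change (lsum (fun c => if Tn_eq l n (S t) (z_of c) then config_weight p c else 0)
            (all_configs l (S t)) = tail t - tail (S t)).
  unfold tail. rewrite <- (rank_mean_old t). unfold rank_mean.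
  rewrite (lsum_ext _ (fun c =>
    1 * (config_weight p c * (if (last (ranks (z_of c) n l t) n <? n)%nat then 1 else 0))
    + (- (1)) * (config_weight p c *
                 (if (last (ranks (z_of c) n l (S t)) n <? n)%nat then 1 else 0)))).
  - rewrite lsum_linear. ring.
  - intros c _. pose proof (Tn_eq_S t (z_of c)) as E.
    destruct (Tn_eq l n (S t) (z_of c)); nra.
Qed.

Hypothesis Hp : forall j, (1 <= j <= l)%nat -> is_prob (p j).

Lemma tail_decr (t : nat) : tail (S t) <= tail t.
Proof.
  assert (0 <= P_Tn_eq l p n (S t)); [|rewrite P_Tn_eq_S in *; lra].
  unfold P_Tn_eq, prob_upto. apply (lsum_nonneg (fun c => _) (all_configs l (S t))).
  intros c Hc. destruct (Tn_eq l n (S t) (z_of c)); [|lra].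
  apply (config_weight_nonneg p l (S t)); auto.
Qed.

Lemma tail_nonneg (t : nat) : 0 <= tail t.
Proof.
  apply lsum_nonneg. intros c Hc. apply Rmult_le_pos.
  - apply (config_weight_nonneg p l t); auto.
  - destruct (last (ranks (z_of c) n l t) n <? n)%nat; lra.
Qed.

(** The right side is a sum of [k] tails, each at least the later one [tail (m + k)]. *)
Lemma tail_mult_bound (m k : nat) :
  INR k * tail (m + k)
  <= mean_passage (map p (seq 1 l)) n (m + k) - mean_passage (map p (seq 1 l)) n m.
Proof.
  induction k as [|k IH].
  - rewrite Nat.add_0_r. simpl. lra.
  - rewrite Nat.add_succ_r, mean_passage_S, S_INR.
    pose proof (tail_decr (m + k)). pose proof (pos_INR k). nra.
Qed.

Lemma P_Tn_eq_partial_sum (N : nat) : sum_f_R0 (fun t => P_Tn_eq l p n t) N = 1 - tail N.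
Proof.
  induction N as [|N IH]; simpl.
  - rewrite P_Tn_eq_0, tail_0. ring.
  - rewrite IH, P_Tn_eq_S. ring.
Qed.

(** Summation by parts; the boundary term [INR N * tail N] has to be shown to vanish. *)
Lemma P_Tn_eq_partial_mean (N : nat) :
  sum_f_R0 (fun t => INR t * P_Tn_eq l p n t) N
  = mean_passage (map p (seq 1 l)) n N - INR N * tail N.
Proof.
  induction N as [|N IH].
  - cbn [sum_f_R0 INR]. unfold mean_passage. cbn [mean_time]. ring.
  - change (sum_f_R0 (fun t => INR t * P_Tn_eq l p n t) (S N)) with
      (sum_f_R0 (fun t => INR t * P_Tn_eq l p n t) N + INR (S N) * P_Tn_eq l p n (S N)).
    rewrite IH, P_Tn_eq_S, mean_passage_S, S_INR. ring.
Qed.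

Lemma P_Tn_eq_sums (L : R) :
  Un_cv (fun tau => mean_passage (map p (seq 1 l)) n tau) L ->
  infinite_sum (fun t => P_Tn_eq l p n t) 1 /\
  infinite_sum (fun t => INR t * P_Tn_eq l p n t) L.
Proof.
  intros HL.
  assert (Hg : Un_growing (fun tau => mean_passage (map p (seq 1 l)) n tau)).
  { intros t. rewrite mean_passage_S. pose proof (tail_nonneg t). lra. }
  pose proof (growing_ineq _ L Hg HL) as Hle. cbv beta in Hle.
  split; intros eps Heps.
  - destruct (HL eps Heps) as [N HN]. exists N. intros t Ht.
    rewrite P_Tn_eq_partial_sum. specialize (HN t Ht).
    pose proof (Hle t). pose proof (Hle (S t)) as H1. rewrite mean_passage_S in H1.
    pose proof (tail_nonneg t). unfold Rdist in *.
    rewrite Rabs_left1 in HN by lra. rewrite Rabs_left1 by lra. lra.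
  (* With [m = t / 2], [tail_mult_bound] bounds [INR t * tail t] by twice the growth of the cut mean
     from [m] to [t], hence by [eps / 2]; the distance of the cut mean from [L] adds at most
     [eps / 4]. *)
  - destruct (HL (eps / 4)) as [N HN]; [lra|]. exists (2 * N)%nat. intros t Ht.
    rewrite P_Tn_eq_partial_mean.
    set (m := (t / 2)%nat).
    assert (Hm : (N <= m /\ m <= t /\ t <= 2 * (t - m))%nat).
    { unfold m. pose proof (Nat.div_mod_eq t 2). pose proof (Nat.mod_upper_bound t 2). lia. }
    pose proof (tail_mult_bound m (t - m)) as Hb.
    replace (m + (t - m))%nat with t in Hb by lia.
    pose proof (HN m ltac:(lia)) as H1. pose proof (HN t ltac:(lia)) as H2.
    pose proof (Hle m). pose proof (Hle t). pose proof (tail_nonneg t).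
    assert (INR t <= 2 * INR (t - m)).
    { replace 2 with (INR 2) by (simpl; ring). rewrite <- mult_INR. apply le_INR. lia. }
    pose proof (pos_INR t). unfold Rdist in *.
    rewrite Rabs_left1 in H1, H2 by lra.
    assert (0 <= INR t * tail t) by (apply Rmult_le_pos; lra).
    assert (INR t * tail t <= 2 * (INR (t - m) * tail t)) by nra.
    rewrite Rabs_left1 by lra. lra.
Qed.

End Configurations.

(** * The delay bound and the monotonicity of the delay *)

Lemma mean_passage_upper (a b : nat) (p : nat -> R) (n tau : nat) :
  (forall i, (1 <= i <= a + S b)%nat -> 0 <= p i < 1) ->
  (forall i, (1 <= i <= a + S b)%nat -> i <> S a -> p i < p (S a)) ->
  mean_passage (map p (seq 1 (a + S b))) n tau
  <= Dbar (a + S b) p (S a) + INR n / (1 - p (S a)).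
Proof.
  intros Hp Hm.
  assert (Hp' : forall i, (1 <= i <= a + S b)%nat -> is_prob (p i))
    by (intros i Hi; destruct (Hp i Hi); split; lra).
  (* The network is split at the worst link, and its upstream part is reversed so that both parts
     start with that link. Each part costs its sum plus one single-link time; the extra term of the
     split cancels one of these two times. *)
  pose proof (mean_passage_split p a b n tau Hp') as Hs.
  pose proof (mean_passage_reverse p (S a) n tau ltac:(intros; apply Hp'; lia)) as Hr.
  destruct (Hp (S a) ltac:(lia)) as [Hpm0 Hpm1].
  cbn [seq map] in Hr, Hs.
  change (map p (seq 1 (S a))) with (p 1%nat :: map p (seq 2 a)) in Hr.
  replace (S (S a) - 1)%nat with (S a) in Hr by lia. rewrite Nat.add_1_r in Hs.
  unfold mean_passage in Hs at 3. unfold mean_passage in Hr at 2.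
  cbn [length] in Hs, Hr.
  pose proof (mean_time_worst_first (p (S a))
    (map (fun i => p (a + i)%nat) (seq 2 b)) n tau Hpm1) as H1.
  pose proof (mean_time_worst_first (p (S a))
    (map (fun i => p (S (S a) - i)%nat) (seq 2 a)) n tau Hpm1) as H2.
  rewrite !map_map in H1, H2.
  specialize (H1 ltac:(apply Forall_forall; intros x Hx; apply in_map_iff in Hx as [i [<- Hi]];
    apply in_seq in Hi; split; [apply Hp | apply Hm]; lia)).
  specialize (H2 ltac:(apply Forall_forall; intros x Hx; apply in_map_iff in Hx as [i [<- Hi]];
    apply in_seq in Hi; split; [apply Hp | apply Hm]; lia)).
  pose proof (mean_time_single_upper (p (S a)) n tau 0 ltac:(lra) ltac:(lia)) as H3.
  rewrite Nat.sub_0_r in H3.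
  change (mean_passage [p (S a)] n tau) with (mean_time [p (S a)] n tau [O]) in Hs.
  set (f := fun i => p (S a) / (p (S a) - p i)).
  (* In both parts position [1] is the worst link, so the sums start at index [2]. *)
  assert (E : Dbar (a + S b) p (S a)
    = lsum (fun i => f (a + i)%nat) (seq 2 b) + lsum (fun i => f (S (S a) - i)%nat) (seq 2 a)).
  { rewrite lsum_seq_reverse. unfold Dbar.
    fold (lsum (fun i => if (i =? S a)%nat then 0 else p (S a) / (p (S a) - p i)) (seq 1 (a + S b))).
    rewrite seq_app, lsum_app.
    rewrite (lsum_ext _ f (seq 1 a)).
    2: { intros i Hi. apply in_seq in Hi. destruct (Nat.eqb_spec i (S a)); [lia|reflexivity]. }
    cbn [seq]. unfold lsum at 2. cbn [map fold_right].
    replace (1 + a)%nat with (S a) by lia. rewrite Nat.eqb_refl.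
    fold (lsum (fun i => if (i =? S a)%nat then 0 else p (S a) / (p (S a) - p i)) (seq (S (S a)) b)).
    rewrite (lsum_ext _ f (seq (S (S a)) b)).
    2: { intros i Hi. apply in_seq in Hi. destruct (Nat.eqb_spec i (S a)); [lia|reflexivity]. }
    rewrite <- (lsum_map f (fun i => a + i)%nat).
    replace (map (fun i => a + i)%nat (seq 2 b)) with (seq (S (S a)) b); [ring|].
    clear.
    assert (H : forall k s, seq (a + s) k = map (fun i => a + i)%nat (seq s k)).
    { induction k as [|k IH]; intros s; auto. simpl. f_equal. rewrite <- IH.
      f_equal; lia. }
    rewrite <- H. f_equal. lia. }
  unfold lsum in E. unfold f in E. lra.
Qed.

(** If one increment fell below [c], concavity would keep all later ones at most equal to it, and
    [u] would eventually drop under the line of slope [c]. *)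
Lemma concave_increment_lower (u : nat -> R) (c : R) :
  (forall n, u (S (S n)) + u n <= u (S n) + u (S n)) ->
  (forall n, INR n * c <= u n) ->
  forall n, u n + c <= u (S n).
Proof.
  intros Hc Hl n. apply Rnot_lt_le. intros Hlt.
  set (d := u (S n) - u n).
  assert (Hinc : forall k, u (S (n + k)) - u (n + k)%nat <= d).
  { induction k as [|k IH].
    - rewrite Nat.add_0_r. unfold d; lra.
    - rewrite Nat.add_succ_r. specialize (Hc (n + k)%nat). lra. }
  assert (Hk : forall k, u (n + k)%nat <= u n + INR k * d).
  { induction k as [|k IH].
    - rewrite Nat.add_0_r. simpl; lra.
    - rewrite Nat.add_succ_r, S_INR. specialize (Hinc k). lra. }
  assert (Hd : 0 < c - d) by (unfold d; lra).
  (* Past this [k], the upper bound [u n + INR k * d] is below [INR (n + k) * c]. *)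
  destruct (INR_unbounded ((u n - INR n * c) / (c - d))) as [k Hkk].
  specialize (Hk k). specialize (Hl (n + k)%nat). rewrite plus_INR in Hl.
  assert (u n - INR n * c < INR k * (c - d)); [|lra].
  apply Rmult_lt_compat_r with (r := c - d) in Hkk; auto.
  unfold Rdiv in Hkk. rewrite Rmult_assoc, Rinv_l in Hkk by lra. lra.
Qed.

Lemma Un_cv_le (u v : nat -> R) (a b : R) :
  (forall k, u k <= v k) -> Un_cv u a -> Un_cv v b -> a <= b.
Proof.
  intros H Hu Hv. apply Rnot_lt_le. intros Hlt.
  destruct (Hu ((a - b) / 2)) as [N1 H1]; [lra|].
  destruct (Hv ((a - b) / 2)) as [N2 H2]; [lra|].
  specialize (H1 (Nat.max N1 N2) ltac:(lia)). specialize (H2 (Nat.max N1 N2) ltac:(lia)).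
  specialize (H (Nat.max N1 N2)). unfold Rdist in *.
  apply Rabs_def2 in H1. apply Rabs_def2 in H2. lra.
Qed.

Theorem theorem1 (l : nat) (p : nat -> R) (m : nat) :
  (1 <= l)%nat ->
  (1 <= m <= l)%nat ->
  (forall i, (1 <= i <= l)%nat -> 0 <= p i < 1) ->
  (forall i, (1 <= i <= l)%nat -> i <> m -> p i < p m) ->
  exists ET : nat -> R,
    (forall n, (1 <= n)%nat ->
       infinite_sum (fun t => P_Tn_eq l p n t) 1 /\
       infinite_sum (fun t => INR t * P_Tn_eq l p n t) (ET n)) /\
    (forall n, (1 <= n)%nat ->
       ET n - INR n / (1 - p m) <= ET (S n) - INR (S n) / (1 - p m)) /\
    (forall n, (1 <= n)%nat ->
       ET n - INR n / (1 - p m) <= Dbar l p m).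
Proof.
  intros Hl Hm Hp Hpm.
  destruct m as [|a]; [lia|].
  (* The worst link is [S a], with [a] links before it and [b] behind it. *)
  set (b := (l - S a)%nat).
  assert (El : l = (a + S b)%nat) by (unfold b; lia).
  clearbody b; subst l.
  assert (Hp' : forall i, (1 <= i <= a + S b)%nat -> is_prob (p i))
    by (intros i Hi; destruct (Hp i Hi); split; lra).
  set (u := fun n tau => mean_passage (map p (seq 1 (a + S b))) n tau).
  assert (Hup : forall n tau, u n tau <= Dbar (a + S b) p (S a) + INR n / (1 - p (S a)))
    by (intros; apply mean_passage_upper; auto).
  assert (Hg : forall n, Un_growing (u n)).
  { intros n tau. apply mean_time_incr. apply Forall_forall. intros x Hx.
    apply in_map_iff in Hx as [i [<- Hi]]. apply in_seq in Hi. apply Hp'; lia. }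
  assert (Hcv : forall n, {L : R | Un_cv (u n) L}).
  { intros n. apply growing_cv; auto.
    exists (Dbar (a + S b) p (S a) + INR n / (1 - p (S a))). intros y [tau ->]. apply Hup. }
  set (ET := fun n => proj1_sig (Hcv n)).
  assert (HET : forall n, Un_cv (u n) (ET n)) by (intros n; exact (proj2_sig (Hcv n))).
  clearbody ET.
  assert (Hlow : forall n, INR n * / (1 - p (S a)) <= ET n).
  { intros n.
    apply (Un_cv_le (fun tau => mean_passage [p (S a)] n tau) (u n)); auto.
    - intros tau. apply mean_passage_server; auto.
    - pose proof (mean_time_single_cv (p (S a)) n n ltac:(apply Hp; lia) (le_n n)) as H.
      rewrite Nat.sub_diag in H. exact H. }
  assert (Hconc : forall n, ET (S (S n)) + ET n <= ET (S n) + ET (S n)).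
  { intros n.
    apply (Un_cv_le (fun tau => u (S (S n)) tau + u n tau) (fun tau => u (S n) tau + u (S n) tau)).
    - intros tau. apply mean_passage_concave; auto.
    - apply CV_plus; auto.
    - apply CV_plus; auto. }
  exists ET. repeat split.
  - apply (P_Tn_eq_sums (a + S b) p n Hl H Hp' (ET n) (HET n)).
  - apply (P_Tn_eq_sums (a + S b) p n Hl H Hp' (ET n) (HET n)).
  - intros n _. pose proof (concave_increment_lower ET _ Hconc Hlow n).
    rewrite S_INR. unfold Rdiv. lra.
  - intros n _.
    assert (ET n <= Dbar (a + S b) p (S a) + INR n / (1 - p (S a))); [|lra].
    apply (Un_cv_le (u n) (fun _ => Dbar (a + S b) p (S a) + INR n / (1 - p (S a)))); auto.
    intros eps Heps; exists O; intros; unfold Rdist; rewrite Rminus_diag, Rabs_R0; auto.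
Qed.
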